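(* Let $d\geq 1$ and let $d_1,d_2,d_3\geq 0$ be integers with $d_1+d_2+d_3\geq 1$. Let $I=I_1\times\dots\times I_{d_1}$ with $I_i=[a_i,b_i]$ for $1\leq i\leq d_1$, and let $\Theta=\Theta_1\times\dots\times\Theta_{d_2+d_3}$ with $\Theta_j=[u_j,v_j]$, where $v_j-u_j=2\pi$ for $1\leq j\leq d_2$ and $0<v_j-u_j<2\pi$ for $d_2+1\leq j\leq d_2+d_3$. Let $K=\sigma(I\times\Theta)\subset\mathbb{R}^d$ where $\sigma=(\sigma_\ell(t,\theta))_{1\leq \ell\leq d}$, $t\in I$, $\theta\in\Theta$, and $$\sigma_\ell\in\bigotimes_{i=1}^{d_1}\mathbb{P}_1(I_i)\otimes\bigotimes_{j=1}^{d_2+d_3}\mathbb{T}_1(\Theta_j),\qquad 1\leq \ell\leq d.$$ Then, for every fixed real $m>1$, $K$ possesses a polynomial mesh $\mathcal{A}_n=\mathcal{A}_n(m)$, $n\geq 1$, with constant $$c=\alpha^{d_1+d_2}\,\beta^{d_3},\qquad \alpha=\alpha(m)=\frac{1}{\cos(\pi/(2m))},\qquad \beta=\beta(m)=\frac{m}{m-1},$$ that is, $$\|p\|_K\leq \alpha^{d_1+d_2}\,\beta^{d_3}\,\|p\|_{\mathcal{A}_n}\qquad\text{for all } p\in\mathbb{P}_n^d(K),$$ and such that $$\mathrm{card}(\mathcal{A}_n)\leq N_1^{d_1}\,N_2^{d_2+d_3},\qquad N_1=\lceil mn+1\rceil,\qquad N_2=\lceil 2mn+1\rceil .$$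
   Context: $\mathbb{P}_n^d(K)$ denotes the space of real $d$-variate polynomials of total degree at most $n$, restricted to $K$. For a bounded real function $f$ on a (discrete or continuous) compact set $X$, $\|f\|_X$ is the sup-norm of $f$ on $X$. For an interval $[a,b]$, $a<b$, $\mathbb{P}_n([a,b])$ is the space of univariate real polynomials of degree at most $n$ restricted to $[a,b]$. For an angular interval $[u,v]$, $\mathbb{T}_n([u,v])=\mathrm{span}(1,\cos\theta,\sin\theta,\dots,\cos(n\theta),\sin(n\theta))$, $\theta\in[u,v]$, is the space of real univariate trigonometric polynomials of degree at most $n$ restricted to $[u,v]$. The tensor product of such spaces is the span of the products of univariate functions, one in each variable (a factor that is an empty product is omitted). A polynomial mesh of a compact set $K\subset\mathbb{R}^d$ with constant $c$ is a sequence of finite subsets $\mathcal{A}_n\subset K$ such that $\|p\|_K\leq c\,\|p\|_{\mathcal{A}_n}$ for all $p\in\mathbb{P}_n^d(K)$, where $c>1$ is independent of $p$ and $n$, and $\mathrm{card}(\mathcal{A}_n)=\mathcal{O}(N^s)$ as $n\to\infty$ for some $s\geq 1$, with $N=\dim(\mathbb{P}_n^d(K))$. *)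

(* Defs.v *)
From HB Require Import structures.
From mathcomp Require Import all_boot all_order all_algebra finmap.
From mathcomp Require Import all_classical all_reals all_analysis.
(* mpoly and MathComp-Analysis have clashing notations. *)
From mathcomp Require mpoly.
Import (canonicals, coercions) mpoly.

Set Implicit Arguments.
Unset Strict Implicit.
Unset Printing Implicit Defensive.

Import Order.TTheory GRing.Theory Num.Theory.
Import numFieldNormedType.Exports.

Local Open Scope classical_set_scope.
Local Open Scope ring_scope.

Section LinearSpan.
Context {F : fieldType} {V : lmodType F}.

Definition lspan (E : set V) : set V :=
  [set v | exists k (c : 'I_k -> F) (e : 'I_k -> V),
    (forall i, E (e i)) /\ v = \sum_(i < k) c i *: e i].

Definition lfree k (e : 'I_k -> V) : Prop :=
  forall c : 'I_k -> F, \sum_(i < k) c i *: e i = 0 -> forall i, c i = 0.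

(* The dimension of a linear subspace W: the number of elements of a basis,
   or the dummy value 0 if there is no finite basis. *)
Definition ldim (W : set V) : nat :=
  xget 0%N [set k | exists e : 'I_k -> V, lfree e /\ lspan (range e) = W].

End LinearSpan.

(* A function on a set X is represented by its extension by 0 outside X, which
   is what f \_ X denotes (the default point of R is 0). *)
Section Spaces.
Context {R : realType}.

Definition supnorm (T : Type) (X : set T) (f : T -> R) : R :=
  sup [set `|f x| | x in X].

(* mpoly.msize p is the total degree plus one, and 0 for p = 0. *)
Definition mpoly_space (d n : nat) (K : set 'rV[R]_d) : set ('rV[R]_d -> R) :=
  [set ((fun x : 'rV[R]_d => mpoly.meval (x ord0) p) \_ K)
    | p in [set p : mpoly.mpoly d R | (mpoly.msize p <= n.+1)%N]].

Definition poly_space (n : nat) (a b : R) : set (R -> R) :=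
  [set (horner p \_ `[a, b]) | p in [set p : {poly R} | (size p <= n.+1)%N]].

Definition trig_space (n : nat) (u v : R) : set (R -> R) :=
  lspan
    ([set ((fun x => cos (k%:R * x)) \_ `[u, v]) | k in [set k | (k <= n)%N]] `|`
     [set ((fun x => sin (k%:R * x)) \_ `[u, v]) | k in [set k | (k <= n)%N]]).

Definition tensor_space (k l : nat) (V : 'I_k -> set (R -> R))
    (W : 'I_l -> set (R -> R)) : set ('rV[R]_k * 'rV[R]_l -> R) :=
  lspan [set h | exists (f : 'I_k -> R -> R) (g : 'I_l -> R -> R),
    [/\ forall i, V i (f i), forall j, W j (g j) &
        h = fun x : 'rV[R]_k * 'rV[R]_l =>
          (\prod_(i < k) f i (x.1 ord0 i)) *
          (\prod_(j < l) g j (x.2 ord0 j))]].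

Definition box (k : nat) (a b : 'I_k -> R) : set 'rV[R]_k :=
  [set x | forall i, a i <= x ord0 i <= b i].

(* The sequence is indexed by n >= 1; the value A 0 is irrelevant. *)
Definition polynomial_mesh (d : nat) (K : set 'rV[R]_d) (c : R)
    (A : nat -> {fset 'rV[R]_d}) : Prop :=
  [/\ compact K,
      1 < c,
      forall n, (0 < n)%N -> [set` A n] `<=` K,
      forall n, (0 < n)%N -> forall p, mpoly_space n K p ->
        supnorm K p <= c * supnorm [set` A n] p &
      exists2 s : R, 1 <= s &
        (fun n => #|` A n|%:R : R) =O_\oo
          (fun n => (ldim (mpoly_space n K))%:R `^ s)].

End Spaces.

(* Main.v *)
Require Import Defs.
From mathcomp Require Import all_boot all_order all_algebra finmap.
From mathcomp Require Import all_classical all_reals all_analysis.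
From mathcomp Require mpoly.
Import (canonicals, coercions) mpoly.
From mathcomp Require Import ring lra zify.

Set Implicit Arguments.
Unset Strict Implicit.
Unset Printing Implicit Defensive.

Import Order.TTheory GRing.Theory Num.Theory.
Import numFieldNormedType.Exports.

Local Open Scope classical_set_scope.
Local Open Scope ring_scope.

(** Composing p in P_n^d with sigma gives a function of the box coordinates that is an
    algebraic polynomial of degree at most n in each t_i and a trigonometric polynomial of
    degree at most n in each theta_j.  So it is enough to sample each univariate space well
    and to take the image under sigma of the grid of the univariate nodes: replacing the
    coordinates by nodes one after the other costs the product of the univariate constants
    ([coordinatewise_sampling]).

    Univariate sampling rests on a comparison with cosines that goes back to M. Riesz
    ([cosine_comparison]): if f takes the value 1 at p0 and |f| <= 1, then |f| >= cos (N h)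
    within distance h of p0 as long as N h < pi/2, provided that a difference
    cos (N (x - c)) - l f(x) never has 2N+2 zeros on the circle unless it vanishes.  Indeed,
    were f smaller than the cosine nearby, then a cosine shifted slightly away, minus a
    multiple of f slightly below 1, would change sign too often.  Equispaced angles with
    half-spacing h thus sample f with constant 1 / cos (N h) ([equispaced_sampling]).
    - On an interval, f(x) = g(mid + half * cos x) is a trigonometric polynomial of degree n,
      and the nodes are the Chebyshev-Lobatto points ([alg_nodes]).
    - On a full circle, f = g ([circle_nodes]).
    - On an arc mid + [-omega, omega] with omega < pi, one substitutes
      sin (theta / 2) = sin (omega / 2) cos y, where theta is measured from mid, and takes
      N = 2n.  The function of y so obtained is not a trigonometric polynomial, but the point
      (cos y, sin y, cos (theta / 2)) lies on a quadratic cone, whose rational parametrization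
      by another angle x turns the differences above into trigonometric polynomials of degree
      2n in x, up to a positive factor ([arc_few_zeros]).  This yields the constant alpha,
      which is at most beta because the cosine is concave on [0, pi/2] ([cos_jordan]).

    The zero count itself is that of real polynomials: in the tangent of the half angle, a
    trigonometric polynomial of degree N becomes a polynomial of degree 2N
    ([trig_poly_zeros]).

    Growth of the cardinality has to be measured against dim P_n^d(K).  If K has two points,
    some coordinate takes all the values of an interval on K, so its powers up to n are
    independent on K and this dimension is at least n + 1 ([ldim_image_gt]); if K is one point, each mesh has at
    most one point. *)

(** * Trigonometric polynomials and their zeros *)

Section Trig.
Context {R : realType}.
Implicit Types (G : R -> R) (N : nat).

(** A trigonometric polynomial of degree at most N is, in the tangent of half the angle
    measured from any base point tau, a polynomial of degree at most 2N times the 2N-th power of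
    the half-angle cosine.  Requiring this at every tau allows the circle to be cut open
    anywhere. *)
Definition trig_poly N G : Prop :=
  continuous G /\
  forall tau, exists2 p : {poly R}, (size p <= N.*2.+1)%N &
    forall y, cos (y / 2) != 0 ->
      G (tau + y) = p.[tan (y / 2)] * cos (y / 2) ^+ N.*2.

Lemma trig_poly_cst N (c : R) : trig_poly N (fun=> c).
Proof.
split=> [x|tau]; first exact: cvg_cst.
exists (c *: (1 + 'X^2 : {poly R}) ^+ N) => [|y y0].
  rewrite (leq_trans (size_scale_leq _ _))// (leq_trans (size_poly_exp_leq _ _))//.
  rewrite ltnS -mul2n leq_mul2r; apply/orP; right.
  have : (size (1 + 'X^2 : {poly R})%R <= 3)%N; last by case: size.
  by rewrite (leq_trans (size_polyD _ _))// size_polyXn size_poly1.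
rewrite !hornerE /= -cos2_tan2// -mul2n exprM -mulrA -exprMn mulVf ?expr1n ?mulr1//.
by rewrite expf_neq0.
Qed.

Lemma trig_polyD N G1 G2 : trig_poly N G1 -> trig_poly N G2 ->
  trig_poly N (fun x => G1 x + G2 x).
Proof.
move=> [c1 t1] [c2 t2]; split=> [x|tau].
  by apply: cvgD; [exact: c1|exact: c2].
have [p1 s1 e1] := t1 tau; have [p2 s2 e2] := t2 tau.
exists (p1 + p2) => [|y y0]; last by rewrite e1// e2// hornerD mulrDl.
by rewrite (leq_trans (size_polyD _ _))// geq_max s1.
Qed.

Lemma trig_polyM N1 N2 G1 G2 : trig_poly N1 G1 -> trig_poly N2 G2 ->
  trig_poly (N1 + N2) (fun x => G1 x * G2 x).
Proof.
move=> [c1 t1] [c2 t2]; split=> [x|tau].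
  by apply: cvgM; [exact: c1|exact: c2].
have [p1 s1 e1] := t1 tau; have [p2 s2 e2] := t2 tau.
exists (p1 * p2) => [|y y0].
  rewrite (leq_trans (size_polyMleq _ _))// doubleD; lia.
by rewrite e1// e2// hornerM doubleD exprD mulrACA.
Qed.

Lemma trig_polyZ N (c : R) G : trig_poly N G -> trig_poly N (fun x => c * G x).
Proof. by move=> tG; have := trig_polyM (trig_poly_cst 0 c) tG. Qed.

Lemma cos_half (x : R) : cos x = 2 * cos (x / 2) ^+ 2 - 1.
Proof.
by rewrite -{1}[x](divfK (_ : 2 != 0 :> R))// mulr_natr cos_mulr2n mulr_natl.
Qed.

Lemma sin_half (x : R) : sin x = 2 * cos (x / 2) * sin (x / 2).
Proof.
by rewrite -{1}[x](divfK (_ : 2 != 0 :> R))// mulr_natr sin_mulr2n -mulrA mulr_natl.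
Qed.

Lemma trig_poly_cos_sin (A B : R) :
  trig_poly 1 (fun x => A * cos x + B * sin x).
Proof.
split=> [x|tau].
  apply: cvgD; (apply: cvgM; first exact: cvg_cst).
    exact: continuous_cos.
  exact: continuous_sin.
pose a := A * cos tau + B * sin tau; pose b := B * cos tau - A * sin tau.
exists (a *: (1 - 'X^2) + (b * 2) *: 'X) => [|y y0].
  rewrite (leq_trans (size_polyD _ _))// geq_max; apply/andP; split.
    rewrite (leq_trans (size_scale_leq _ _))// (leq_trans (size_polyD _ _))//.
    by rewrite size_polyN size_polyXn size_poly1.
  by rewrite (leq_trans (size_scale_leq _ _))// size_polyX.
rewrite cosD sinD.
have -> : cos y = cos (y / 2) ^+ 2 - sin (y / 2) ^+ 2.
  by rewrite cos_half sin2cos2; ring.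
rewrite (sin_half y).
rewrite !hornerE /= /tan /a /b.
by field.
Qed.

Lemma trig_poly_widen N1 N2 G : (N1 <= N2)%N -> trig_poly N1 G -> trig_poly N2 G.
Proof.
move=> /subnKC <- tG; have := trig_polyM tG (trig_poly_cst (N2 - N1) 1).
by under [X in trig_poly _ X]eq_fun do rewrite mulr1.
Qed.

Lemma trig_poly_sum N k (G : 'I_k -> R -> R) :
  (forall i, trig_poly N (G i)) -> trig_poly N (fun x => \sum_i G i x).
Proof.
elim: k G => [|k IH] G tG.
  by under [X in trig_poly _ X]eq_fun do rewrite big_ord0; exact: trig_poly_cst.
under [X in trig_poly _ X]eq_fun do rewrite big_ord_recl.
by apply: trig_polyD => //; apply: IH.
Qed.

Lemma trig_polyX N k G : trig_poly N G -> trig_poly (k * N) (fun x => G x ^+ k).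
Proof.
move=> tG; elim: k => [|k IH]; first exact: trig_poly_cst.
by under [X in trig_poly _ X]eq_fun do rewrite exprS; exact: trig_polyM.
Qed.

Lemma trig_poly_horner k (p : {poly R}) G : (size p <= k.+1)%N ->
  trig_poly 1 G -> trig_poly k (fun x => p.[G x]).
Proof.
move=> sp tG; under [X in trig_poly _ X]eq_fun do rewrite horner_coef.
apply: trig_poly_sum => i; apply: trig_polyZ.
apply: trig_poly_widen (trig_polyX i tG).
by rewrite muln1 -ltnS (leq_trans (ltn_ord i)).
Qed.

(** Taking x as base point and y - x as angle leaves only the value of the polynomial at 0, up to
    the sign of a half-angle cosine, whose even power is 1.  This is how periodicity is used. *)
Lemma trig_poly_circle N G x y : trig_poly N G ->
  cos x = cos y -> sin x = sin y -> G x = G y.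
Proof.
move=> [_ /(_ x) [p _ pE]] cxy sxy.
have : cos (y - x) = 1 by rewrite cosB cxy sxy -!expr2 cos2Dsin2.
rewrite cos_half cos2sin2 => s0.
have {}s0 : sin ((y - x) / 2) = 0.
  by apply/eqP; rewrite -sqrf_eq0; apply/eqP; lra.
have c1 : cos ((y - x) / 2) ^+ 2 = 1 by rewrite cos2sin2 s0; lra.
have c0 : cos ((y - x) / 2) != 0.
  by apply/eqP => c0; move: c1; rewrite c0; lra.
have := pE _ c0; rewrite addrCA subrr addr0 /tan s0 mul0r -mul2n exprM c1 expr1n mulr1.
have := pE 0; rewrite mul0r addr0 cos0 oner_neq0 tan0 expr1n mulr1 => -> //.
Qed.

Lemma tan_half_circle (x y : R) : cos (x / 2) != 0 -> cos (y / 2) != 0 ->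
  tan (x / 2) = tan (y / 2) -> cos x = cos y /\ sin x = sin y.
Proof.
have half (z : R) : cos (z / 2) != 0 -> cos z = 2 / (1 + tan (z / 2) ^+ 2) - 1 /\
   sin z = 2 * tan (z / 2) / (1 + tan (z / 2) ^+ 2).
  move=> z0; rewrite -cos2_tan2// invrK; move: z0.
  by rewrite (cos_half z) (sin_half z) /tan => z0; split; field.
by move=> /half [-> ->] /half [-> ->] ->.
Qed.

Lemma uniq_map_inj (S T : eqType) (f : S -> T) (s : seq S) :
  uniq [seq f i | i <- s] -> {in s &, injective f}.
Proof.
move=> us x y xs ys fxy; apply: (@index_inj _ x s x y xs ys).
have := nth_uniq (f x) _ _ us; rewrite size_map => /(_ (index x s) (index y s)).
rewrite !index_mem => /(_ xs ys).
by rewrite !(nth_map x) ?index_mem// !nth_index// fxy eqxx => /esym/eqP.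
Qed.

(** Zeros are told apart by their points on the circle, so that no choice of a period is
    needed. *)
Definition circle_pt (x : R) : R * R := (cos x, sin x).

(** Cutting the circle at one of the zeros leaves 2N+1 distinct roots of a polynomial of degree
    2N in the half-angle tangent.  The bound is one zero weaker than the sharp one, which asks
    only for 2N+1 zeros. *)
Lemma trig_poly_zeros N G (zs : seq R) : trig_poly N G ->
  uniq [seq circle_pt z | z <- zs] -> (N.*2.+1 < size zs)%N ->
  (forall z, z \in zs -> G z = 0) -> forall x, G x = 0.
Proof.
case: zs => [//|w zs] tG /= /andP[wzs uzs]; rewrite ltnS => szs G0.
(* The half-angle tangent measured from w + pi is infinite exactly at w. *)
have [_ /(_ (w + pi)) [p sp pE]] := tG.
have cE z : cos ((z - (w + pi)) / 2) = sin ((z - w) / 2).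
  by rewrite opprD addrA mulrBl cosBpihalf.
have cut z : cos ((z - (w + pi)) / 2) = 0 -> circle_pt z = circle_pt w.
  rewrite cE => s0; suff [c1 s1] : cos (z - w) = 1 /\ sin (z - w) = 0.
    by rewrite -[z](subrK w) /circle_pt (cosD (z - w)) (sinD (z - w)) c1 s1; congr pair; lra.
  by rewrite cos_half sin_half cos2sin2 s0; split; lra.
have GE z : cos ((z - (w + pi)) / 2) != 0 ->
   G z = p.[tan ((z - (w + pi)) / 2)] * cos ((z - (w + pi)) / 2) ^+ N.*2.
  by move=> /pE; rewrite addrC subrK.
have zne z : z \in zs -> cos ((z - (w + pi)) / 2) != 0.
  move=> zz; apply/eqP => /cut zw; move: wzs; rewrite -zw.
  by rewrite map_f.
suff p0 : p = 0.
  move=> x; have [/cut|x0] := eqVneq (cos ((x - (w + pi)) / 2)) 0.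
    by case=> cx sx; rewrite (trig_poly_circle tG cx sx) G0 ?mem_head.
  by rewrite GE// p0 horner0 mul0r.
apply: (@roots_geq_poly_eq0 _ p [seq tan ((z - (w + pi)) / 2) | z <- zs]).
- apply/allP => _ /mapP[z zz ->]; apply/rootP.
  have /eqP := GE _ (zne _ zz); rewrite G0 ?in_cons ?zz ?orbT// eq_sym mulf_eq0.
  by rewrite expf_eq0 (negbTE (zne _ zz)) andbF orbF => /eqP.
- rewrite map_inj_in_uniq; first exact: map_uniq uzs.
  move=> y z yz zz /(tan_half_circle (zne _ yz) (zne _ zz)) [c s].
  have cyz : circle_pt y = circle_pt z.
    rewrite -[y](subrK (w + pi)) -[z](subrK (w + pi)) /circle_pt.
    by rewrite !(cosD _ (w + pi)) !(sinD _ (w + pi)) c s.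
  exact: (uniq_map_inj uzs).
- by rewrite size_map (leq_trans sp).
Qed.
End Trig.

(** * Comparison with cosines *)

Section Comparison.
Context {R : realType}.
Implicit Types (f g : R -> R) (N : nat).

(** The unique continuation property of trigonometric polynomials of degree N, stated by itself
    because it also holds for functions of an angle that are not trigonometric polynomials. *)
Definition few_zeros N g : Prop :=
  forall zs : seq R, uniq [seq circle_pt z | z <- zs] -> (N.*2.+1 < size zs)%N ->
    (forall z, z \in zs -> g z = 0) -> forall x, g x = 0.

(** Serves both for the reflection of the angle and for its non-linear change on an arc. *)
Lemma few_zeros_transfer N g G (phi : R -> R) :
  (forall x y, circle_pt (phi x) = circle_pt (phi y) -> circle_pt x = circle_pt y) ->
  (forall x, g x = 0 <-> G (phi x) = 0) -> few_zeros N G -> few_zeros N g.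
Proof.
move=> phi_inj gG fG zs uzs szs g0 x; apply/gG.
apply: (fG [seq phi z | z <- zs]); last 2 first.
- by rewrite size_map.
- by move=> _ /mapP[z zz ->]; apply/gG/g0.
rewrite -map_comp map_inj_in_uniq; first exact: map_uniq uzs.
by move=> y z yz zz /phi_inj /(uniq_map_inj uzs yz zz).
Qed.

Lemma cos_natpi k : cos (k%:R * pi) = (-1) ^+ k :> R.
Proof.
elim: k => [|k IH]; first by rewrite mul0r cos0.
by rewrite -natr1 mulrDl mul1r cosDpi IH exprS mulN1r.
Qed.

Lemma circle_pt_neq (x y : R) : x < y < x + 2 * pi -> circle_pt x != circle_pt y.
Proof.
move=> /andP[xy yx]; apply/eqP => -[cxy sxy].
have : cos (y - x) = 1 by rewrite cosB cxy sxy -!expr2 cos2Dsin2.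
rewrite cos_half cos2sin2 => s0.
have : 0 < sin ((y - x) / 2) by apply: sin_gt0_pi; lra.
move=> /(exprn_gt0 2); lra.
Qed.

(** The zeros given by the intermediate value theorem lie in disjoint open intervals that fit in
    one period, hence they are distinct on the circle. *)
Lemma alternating_zeros n g (q : nat -> R) : continuous g ->
  (forall k, (k < n)%N -> q k < q k.+1) ->
  (forall k, (k <= n)%N -> 0 < (-1) ^+ k * g (q k)) ->
  q n <= q 0%N + 2 * pi ->
  exists zs : seq R, [/\ uniq [seq circle_pt z | z <- zs], size zs = n &
    forall z, z \in zs -> g z = 0].
Proof.
move=> cg qinc gsgn qn.
have zP k : exists z, (k < n)%N -> q k < z < q k.+1 /\ g z = 0.
  have [kn|] := boolP (k < n)%N; last by exists 0.
  have q1 := qinc _ kn; have s1 := gsgn _ (ltnW kn); have s2 := gsgn _ kn.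
  have [z zI gz] : exists2 z, z \in `[q k, q k.+1] & g z = 0.
    apply: IVT; [exact: ltW|exact: continuous_subspaceT|].
    rewrite ge_min le_max; move: s1 s2; rewrite exprS mulN1r.
    by rewrite -signr_odd; case: (odd k); rewrite ?expr0 ?expr1; lra.
  exists z => _; split=> //; move: zI; rewrite in_itv/= !le_eqVlt.
  move=> /andP[/predU1P[qz|->] /predU1P[zq|->]] //.
  - by rewrite qz zq ltxx in q1.
  - by rewrite qz gz mulr0 ltxx in s1.
  - by rewrite -zq gz mulr0 ltxx in s2.
have {zP}[z zP] := choice zP.
have qle i j : (i <= j <= n)%N -> q i <= q j.
  move=> /andP[]; elim: j => [|j IH]; first by rewrite leqn0 => /eqP ->.
  rewrite leq_eqVlt => /predU1P[->//|]; rewrite ltnS => ij jn.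
  by rewrite (le_trans (IH ij (ltnW jn)))// ltW// qinc.
have zneq i j : (i < j < n)%N -> circle_pt (z i) != circle_pt (z j).
  move=> /andP[ij jn]; have inn := ltn_trans ij jn.
  have [/andP[zi1 zi2] _] := zP _ inn; have [/andP[zj1 zj2] _] := zP _ jn.
  have := qle i.+1 j; rewrite ij (ltnW jn) => /(_ isT) ?.
  have := qle 0%N i; rewrite (ltnW inn) => /(_ isT) ?.
  have := qle j.+1 n; rewrite jn leqnn => /(_ isT) ?.
  by apply: circle_pt_neq; lra.
exists [seq z i | i <- iota 0 n]; split.
- rewrite -map_comp map_inj_in_uniq ?iota_uniq// => i j; rewrite !mem_iota /= !add0n.
  move=> inn jn eij; case: (ltngtP i j) => // [ij|ji].
    by have := zneq i j; rewrite ij jn eij eqxx => /(_ isT).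
  by have := zneq j i; rewrite ji inn eij eqxx => /(_ isT).
- by rewrite size_map size_iota.
- by move=> _ /mapP[i + ->]; rewrite mem_iota => /zP[].
Qed.

(** Suppose |f p1| < cos (N h).  The cosine of N (x - s), with s slightly to the left of p0, is
    below l f at p0 for some l < 1 close to 1, but still above it at s and at p1; and it alternates
    with amplitude 1 > l at the points s + k pi / N.  So the signs of the difference alternate at the
    2N+3 points s, p0, p1, s + pi / N, ..., s + 2 pi, and it has 2N+2 zeros.  Shifting the cosine and scaling f avoids the double zero at p0, hence
    multiplicities. *)
Lemma cosine_comparison_right N f (p0 p1 h : R) : (0 < N)%N -> continuous f ->
  (forall x, `|f x| <= 1) -> f p0 = 1 ->
  (forall l c, few_zeros N (fun x => cos (N%:R * (x - c)) - l * f x)) ->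
  p0 < p1 <= p0 + h -> N%:R * h < pi / 2 ->
  cos (N%:R * h) <= `|f p1|.
Proof.
move=> N0 cf f1 fp0 fz /andP[p01 p1h] Nh; rewrite leNgt; apply/negP => fp1.
have Npos : 0 < N%:R :> R by rewrite ltr0n.
have pi0 := pi_gt0 R.
set c := `|f p1| in fp1; have c0 : 0 <= c by exact: normr_ge0.
have c1 : c <= 1 by exact: f1.
have h0 : 0 < N%:R * h by rewrite mulr_gt0//; lra.
have cI : c \in `[-1, 1] by rewrite in_itv/=; lra.
have cI' : -1 <= c <= 1 by lra.
have [ac0 ac1] := (acos_ge0 cI', acos_lepi cI').
have ach : N%:R * h < acos c.
  by rewrite -ltr_cos ?acosK// in_itv/=; lra.
have acpi : acos c <= pi / 2.
  rewrite leNgt; apply/negP => acpi.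
  have : cos (acos c) < cos (pi / 2) by rewrite ltr_cos// in_itv/=; lra.
  by rewrite acosK// cos_pihalf; lra.
(* H lies strictly between N h and acos c, so that cos H is still above c; the shift d moves N h
   to H. *)
pose H := (N%:R * h + acos c) / 2.
have cH : c < cos H.
  by rewrite -[ltLHS](acosK cI) ltr_cos ?in_itv/= /H; lra.
pose d := (H - N%:R * h) / N%:R.
have Nd : N%:R * d = H - N%:R * h by rewrite /d mulrC divfK// gt_eqF.
have d0 : 0 < d by rewrite /d divr_gt0// /H; lra.
have cd1 : cos (N%:R * d) < 1.
  by rewrite Nd -[ltRHS]cos0 ltr_cos ?in_itv/= /H; lra.
have cd0 : 0 < cos (N%:R * d).
  by apply: cos_gt0_pihalf; rewrite Nd /H; lra.
pose l := (1 + cos (N%:R * d)) / 2; pose s := p0 - d.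
have l0 : 0 < l by rewrite /l; lra.
have l1 : l < 1 by rewrite /l; lra.
have lf x : - l <= l * f x <= l.
  by rewrite -ler_norml normrM (gtr0_norm l0) ler_piMr// ltW.
pose g x := cos (N%:R * (x - s)) - l * f x.
have cg : continuous g.
  move=> x; apply: cvgB; last by apply: cvgM; [exact: cvg_cst|exact: cf].
  apply: continuous_comp; last exact: continuous_cos.
  by apply: cvgM; [exact: cvg_cst|apply: cvgB; [exact: cvg_id|exact: cvg_cst]].
(* The 2N+3 points of alternation, the last being s + 2 pi. *)
pose q k := if k is j.+3 then s + j.+1%:R * (pi / N%:R)
  else if k == 2%N then p1 else if k == 1%N then p0 else s.
have step : N%:R * (pi / N%:R) = pi :> R by rewrite mulrC divfK// gt_eqF.
have step0 : 0 < pi / N%:R :> R by rewrite divr_gt0.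
have p1s : N%:R * (p1 - s) <= H.
  have -> : N%:R * (p1 - s) = N%:R * (p1 - p0) + N%:R * d by rewrite /s; ring.
  have : N%:R * (p1 - p0) <= N%:R * h by rewrite ler_pM2l//; lra.
  by rewrite Nd; lra.
have p1s0 : 0 <= N%:R * (p1 - s) by rewrite mulr_ge0// /s; lra.
have Hpi : H < pi / 2 by rewrite /H; lra.
have qinc k : q k < q k.+1.
  case: k => [|[|[|k]]] /=; first by rewrite /s; lra.
  - by [].
  - rewrite mul1r -ltrBlDl -(ltr_pM2l Npos) step; lra.
  - by rewrite ltrD2l ltr_pM2r// ltr_nat.
have gsgn k : 0 < (-1) ^+ k * g (q k).
  case: k => [|[|[|k]]] /=; rewrite /g.
  - rewrite expr0 mul1r subrr mulr0 cos0; have := lf s; lra.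
  - by rewrite expr1 mulN1r fp0 mulr1 /s subKr /l; lra.
  - rewrite -signr_odd /= expr0 mul1r.
    have : cos H <= cos (N%:R * (p1 - s)) by rewrite leNgt ltr_cos ?in_itv/= -?leNgt; lra.
    have : l * f p1 <= c.
      rewrite (le_trans (ler_norm _))// normrM (gtr0_norm l0) ler_piMl// ltW//.
    by move: cH; lra.
  - rewrite addrAC subrr add0r mulrCA step cos_natpi !exprS !mulN1r opprK.
    have := lf (s + k.+1%:R * (pi / N%:R)).
    by rewrite -signr_odd; case: (odd k); rewrite ?expr0 ?expr1; lra.
have q2 : q (N.*2.+2) = s + 2 * pi.
  have -> : q N.*2.+2 = s + N.*2%:R * (pi / N%:R).
    by rewrite -(prednK (_ : (0 < N.*2)%N)) ?double_gt0.
  by rewrite -mul2n natrM -mulrA step.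
have [|||zs [uzs szs gz]] := @alternating_zeros N.*2.+2 g q cg.
- by move=> k _; exact: qinc.
- by move=> k _; exact: gsgn.
- by rewrite q2.
have := fz l s zs uzs; rewrite szs leqnn => /(_ isT gz s) gs0.
by have := gsgn 0%N; rewrite /= /g expr0 mul1r gs0 ltxx.
Qed.

(** The normalization f p0 = 1 and the order p0 < p1 are obtained by scaling f and by reflecting
    the angle. *)
Lemma cosine_comparison N f (p0 p1 h : R) : (0 < N)%N -> continuous f ->
  (forall x, `|f x| <= `|f p0|) ->
  (forall l c, few_zeros N (fun x => cos (N%:R * (x - c)) - l * f x)) ->
  `|p1 - p0| <= h -> N%:R * h < pi / 2 ->
  cos (N%:R * h) * `|f p0| <= `|f p1|.
Proof.
move=> N0 cf fmax fz p01 Nh.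
have [f0|f0] := eqVneq (f p0) 0; first by rewrite f0 normr0 mulr0.
have nf0 : 0 < `|f p0| by rewrite normr_gt0.
have [->|pne] := eqVneq p1 p0; first by rewrite ler_piMl// cos_le1.
rewrite -ler_pdivlMr// -normf_div.
pose F x := f x / f p0.
have cF : continuous F by move=> x; apply: cvgM; [exact: cf|exact: cvg_cst].
have F1 x : `|F x| <= 1 by rewrite normf_div ler_pdivrMr// mul1r.
have Fp0 : F p0 = 1 by rewrite /F divff.
have Fz l c : few_zeros N (fun x => cos (N%:R * (x - c)) - l * F x).
  have -> : (fun x => cos (N%:R * (x - c)) - l * F x) =
            (fun x => cos (N%:R * (x - c)) - l / f p0 * f x).
    by apply/funext => x; congr (_ - _); rewrite /F mulrA mulrAC.
  exact: fz.
have [p1lt|p1gt] := ltP p0 p1.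
  by apply: (cosine_comparison_right N0 cF F1 Fp0 Fz _ Nh); move: p01; rewrite ler_norml p1lt /=; lra.
have -> : f p1 / f p0 = F (- - p1) by rewrite opprK.
apply: (@cosine_comparison_right N (F \o -%R) (- p0)) => //=.
- by move=> x; apply: continuous_comp; [exact: opp_continuous|exact: cF].
- by rewrite opprK.
- move=> l c; apply: (@few_zeros_transfer _ _ _ -%R) (Fz l (- c)).
    by move=> x y; rewrite /circle_pt !cosN !sinN => -[-> /oppr_inj ->].
  move=> x; have -> : N%:R * (- x - - c) = - (N%:R * (x - c)) by ring.
  by rewrite cosN.
- move: p01; rewrite ler_norml; move: pne; rewrite neq_lt; lra.
Qed.
End Comparison.

(** * Sampling on intervals and circles *)

Section Sampling.
Context {R : realType}.
Implicit Types (f g : R -> R) (N n M : nat).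

Lemma angle_exists (c s : R) : c ^+ 2 + s ^+ 2 = 1 ->
  exists2 x, 0 <= x <= 2 * pi & circle_pt x = (c, s).
Proof.
move=> cs1; have pi0 := pi_gt0 R.
have s2 := sqr_ge0 s.
have cI : -1 <= c <= 1.
  by rewrite -ler_norml -(@ler_pXn2r _ 2)// ?nnegrE// expr1n real_normK ?num_real//; lra.
have cI' : c \in `[-1, 1] by rewrite in_itv.
have [a0 api] := (acos_ge0 cI, acos_lepi cI).
have ss : Num.sqrt (1 - c ^+ 2) = `|s| by rewrite -sqrtr_sqr; congr Num.sqrt; lra.
have [s0|s0] := leP 0 s.
  exists (acos c); first by lra.
  by rewrite /circle_pt acosK// sin_acos// ss ger0_norm.
exists (2 * pi - acos c); first by lra.
have -> : 2 * pi - acos c = - acos c + pi *+ 2 by ring.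
rewrite /circle_pt cosD2pi sinD2pi cosN sinN acosK// sin_acos// ss.
by rewrite ltr0_norm// opprK.
Qed.

Lemma equispaced_nearest M (P p : R) : (0 < M)%N -> 0 < P -> 0 <= p <= P ->
  exists k : 'I_M.+1, `|k%:R * (P / M%:R) - p| <= P / (2 * M%:R).
Proof.
move=> M0 P0 /andP[p0 pP].
have M0' : 0 < M%:R :> R by rewrite ltr0n.
(* Adding 1/2 before truncating rounds p to the nearest multiple of P / M. *)
set y := p * M%:R / P + 2^-1.
have y0 : 0 <= y by rewrite addr_ge0 ?invr_ge0// divr_ge0 ?(ltW P0)// mulr_ge0// ltW.
have /andP[ky yk] := truncn_itv y0.
have yM : y < M.+1%:R.
  rewrite -natr1 /y; have : p * M%:R / P <= M%:R by rewrite ler_pdivrMr// mulrC ler_pM2l.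
  lra.
have kM : (Num.truncn y < M.+1)%N by rewrite -(ltr_nat R) (le_lt_trans ky).
exists (Ordinal kM) => /=.
have -> : (Num.truncn y)%:R * (P / M%:R) - p = ((Num.truncn y)%:R - y + 2^-1) * (P / M%:R).
  by rewrite /y; field; rewrite !gt_eqF.
have -> : P / (2 * M%:R) = 2^-1 * (P / M%:R) by field; rewrite gt_eqF.
rewrite normrM [X in _ * X <= _]gtr0_norm ?divr_gt0// ler_pM2r ?divr_gt0//.
rewrite ler_norml; move: ky yk; rewrite -natr1; lra.
Qed.

(** The maximum of |f| is attained at some p0 in [0, P], and the comparison with cosines applies
    between p0 and the node nearest to it, at distance at most h = P / (2 M). *)
Lemma equispaced_sampling N M f (P m : R) : (0 < N)%N -> (0 < M)%N -> 0 < P -> 1 < m ->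
  continuous f -> (forall x, exists2 x', 0 <= x' <= P & f x' = f x) ->
  (forall l c, few_zeros N (fun x => cos (N%:R * (x - c)) - l * f x)) ->
  N%:R * (P / (2 * M%:R)) <= pi / (2 * m) ->
  forall x, exists k : 'I_M.+1,
    `|f x| <= 1 / cos (pi / (2 * m)) * `|f (k%:R * (P / M%:R))|.
Proof.
move=> N0 M0 P0 m1 cf fper fz NP x.
have pi0 := pi_gt0 R.
have [pm0 pm1] : 0 < pi / (2 * m) /\ pi / (2 * m) < pi / 2.
  split; first by rewrite divr_gt0//; lra.
  by rewrite ltr_pM2l// ltf_pV2 ?posrE; lra.
have cm : 0 < cos (pi / (2 * m)) by apply: cos_gt0_pihalf; lra.
have [p0 pI pmax] : exists2 p0, 0 <= p0 <= P & forall x, `|f x| <= `|f p0|.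
  have : {within `[0, P], continuous (fun y => `|f y|)}.
    by apply: continuous_subspaceT => y; apply: continuous_comp; [exact: cf|exact: norm_continuous].
  move=> /(EVT_max (ltW P0)) [p0 pI pmax]; exists p0; first by move: pI; rewrite in_itv.
  by move=> y; have [y' yI <-] := fper y; apply: pmax; rewrite in_itv.
have [k kp] := equispaced_nearest M0 P0 pI.
exists k; rewrite div1r mulrC ler_pdivlMr// (le_trans (ler_pM _ (ltW cm) (pmax x) (lexx _)))//.
have Nh : N%:R * (P / (2 * M%:R)) < pi / 2 by lra.
have := cosine_comparison N0 cf pmax fz kp Nh; apply: le_trans.
rewrite mulrC ler_wpM2r//.
have h0 : 0 <= N%:R * (P / (2 * M%:R)) by rewrite mulr_ge0// divr_ge0// ltW.
by rewrite leNgt ltr_cos ?in_itv/= -?leNgt; lra.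
Qed.

(** A combination of cos (k y) and sin (k y) is a form of degree k in (cos y, sin y); on the
    multiple (cos x, kap sin x) of that vector, the form is a trigonometric polynomial of
    degree k in x.  The circle itself is the case kap = rho = 1. *)
Lemma trig_poly_ellipse (kap : R) k (A B : R) : exists2 h, trig_poly k h &
  forall x y rho, cos x = rho * cos y -> kap * sin x = rho * sin y ->
    h x = rho ^+ k * (A * cos (k%:R * y) + B * sin (k%:R * y)).
Proof.
elim: k A B => [|k IH] A B.
  exists (fun=> A) => [|x y rho _ _]; first exact: trig_poly_cst.
  by rewrite mul0r cos0 sin0; ring.
have [h1 t1 e1] := IH A B; have [h2 t2 e2] := IH B (- A).
exists (fun x => (1 * cos x + 0 * sin x) * h1 x + (0 * cos x + kap * sin x) * h2 x).
  by apply: trig_polyD; (apply: (@trig_polyM _ 1 k); first exact: trig_poly_cos_sin).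
move=> x y rho cxy sxy; rewrite (e1 _ _ _ cxy sxy) (e2 _ _ _ cxy sxy) sxy cxy.
have -> : k.+1%:R * y = k%:R * y + y by rewrite -natr1 mulrDl mul1r.
rewrite cosD sinD exprS; ring.
Qed.

Lemma trig_poly_shift n g (a : R) : trig_poly n g -> trig_poly n (fun x => g (a + x)).
Proof.
move=> [cg tg]; split=> [x|tau].
  by apply: continuous_comp; [apply: cvgD; [exact: cvg_cst|exact: cvg_id]|exact: cg].
by have [p sp pE] := tg (a + tau); exists p => // y /pE; rewrite addrA.
Qed.

Lemma trig_poly_few_zeros N f : trig_poly N f ->
  forall l c, few_zeros N (fun x => cos (N%:R * (x - c)) - l * f x).
Proof.
move=> tf l c; have [h th hE] := trig_poly_ellipse 1 N (cos (N%:R * c)) (sin (N%:R * c)).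
have -> : (fun x => cos (N%:R * (x - c)) - l * f x) = (fun x => h x + (- l) * f x).
  apply/funext => x; rewrite (hE x x 1) ?mul1r// expr1n mul1r mulNr.
  by rewrite mulrBr cosB; congr (_ - _); ring.
by move=> zs; apply: trig_poly_zeros; apply: trig_polyD => //; exact: trig_polyZ.
Qed.

Definition alg_poly n g : Prop :=
  exists2 p : {poly R}, (size p <= n.+1)%N & forall x, g x = p.[x].

(** The nodes are the Chebyshev-Lobatto points: g becomes a trigonometric polynomial of the same
    degree under t = mid + half * cos x, and x ranges over [0, pi]. *)
Lemma alg_nodes n M (m a b : R) : (0 < n)%N -> 1 < m -> m * n%:R <= M%:R -> a < b ->
  exists2 X : 'I_M.+1 -> R, forall k, a <= X k <= b &
    forall g, alg_poly n g -> forall t, a <= t <= b -> exists k,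
      `|g t| <= 1 / cos (pi / (2 * m)) * `|g (X k)|.
Proof.
move=> n0 m1 nM ab; have pi0 := pi_gt0 R.
have n0' : 0 < n%:R :> R by rewrite ltr0n.
have M0' : 0 < M%:R :> R by rewrite (lt_le_trans _ nM)// mulr_gt0//; lra.
have M0 : (0 < M)%N by rewrite -(ltr0n R).
pose th x := (a + b) / 2 + (b - a) / 2 * cos x.
have thI x : a <= th x <= b.
  have ba : 0 <= (b - a) / 2 by lra.
  have := ler_wpM2l ba (cos_le1 x); have := ler_wpM2l ba (cos_geN1 x); rewrite /th; lra.
exists (fun k : 'I_M.+1 => th (k%:R * (pi / M%:R))) => // g [p sp gE] t tI.
have tg : trig_poly n (g \o th).
  have -> : g \o th = fun x => p.[(a + b) / 2 + ((b - a) / 2 * cos x + 0 * sin x)].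
    by apply/funext => x; rewrite /= gE /th mul0r addr0.
  apply: trig_poly_horner => //; apply: trig_polyD; first exact: trig_poly_cst.
  exact: trig_poly_cos_sin.
have fper x : exists2 x', 0 <= x' <= pi & (g \o th) x' = (g \o th) x.
  have cI : -1 <= cos x <= 1 by rewrite cos_geN1 cos_le1.
  exists (acos (cos x)); first by rewrite acos_ge0// acos_lepi.
  by rewrite /= /th acosK// in_itv.
have Nh : n%:R * (pi / (2 * M%:R)) <= pi / (2 * m).
  rewrite mulrA ler_pdivrMr ?mulr_gt0// mulrAC ler_pdivlMr; last lra.
  have := ler_wpM2l (ltW pi0) nM; lra.
have [k] := equispaced_sampling n0 M0 pi0 m1 tg.1 fper (trig_poly_few_zeros tg) Nh
  (acos ((t - (a + b) / 2) / ((b - a) / 2))).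
rewrite /= {1}/th acosK; last first.
  by rewrite in_itv/= ler_pdivlMr ?ler_pdivrMr; lra.
rewrite [(b - a) / 2 * _]mulrC divfK; last by rewrite gt_eqF//; lra.
by rewrite [_ + (t - _)]addrC subrK => kP; exists k.
Qed.

(** Both endpoints are nodes, although they agree modulo 2 pi: with them the nearest node never
    has to be taken modulo the period. *)
Lemma circle_nodes n M (m u v : R) : (0 < n)%N -> 1 < m -> 2 * m * n%:R <= M%:R ->
  v - u = 2 * pi ->
  exists2 X : 'I_M.+1 -> R, forall k, u <= X k <= v &
    forall g, trig_poly n g -> forall t, u <= t <= v -> exists k,
      `|g t| <= 1 / cos (pi / (2 * m)) * `|g (X k)|.
Proof.
move=> n0 m1 nM uv; have pi0 := pi_gt0 R.
have n0' : 0 < n%:R :> R by rewrite ltr0n.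
have M0' : 0 < M%:R :> R by rewrite (lt_le_trans _ nM)// !mulr_gt0//; lra.
have M0 : (0 < M)%N by rewrite -(ltr0n R).
have pi20 : 0 < 2 * pi :> R by lra.
exists (fun k : 'I_M.+1 => u + k%:R * (2 * pi / M%:R)) => [k|g tg t tI].
  have k0 : 0 <= k%:R * (2 * pi / M%:R) :> R by rewrite mulr_ge0// divr_ge0// ltW.
  have : k%:R * (2 * pi / M%:R) <= 2 * pi :> R.
    by rewrite mulrA ler_pdivrMr// mulrC ler_pM2l// ler_nat -ltnS.
  lra.
have tf := trig_poly_shift u tg.
have fper x : exists2 x', 0 <= x' <= 2 * pi & g (u + x') = g (u + x).
  have [x' xI [cx sx]] := angle_exists (cos2Dsin2 x).
  by exists x' => //; exact: (trig_poly_circle tf).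
have Nh : n%:R * (2 * pi / (2 * M%:R)) <= pi / (2 * m).
  rewrite mulrA ler_pdivrMr ?mulr_gt0// mulrAC ler_pdivlMr; last lra.
  have := ler_wpM2l (ltW pi0) nM; lra.
have [k] := equispaced_sampling n0 M0 pi20 m1 tf.1 fper (trig_poly_few_zeros tf) Nh (t - u).
by rewrite [u + (t - u)]addrC subrK => kP; exists k.
Qed.

End Sampling.

(** * Sampling on arcs *)

Section Arc.
Context {R : realType}.
Implicit Types (f g : R -> R) (N n M : nat).

(** Concavity of the cosine: below the chord, the mean value theorem on both sides of x would
    give two slopes in the wrong order. *)
Lemma cos_jordan (x : R) : 0 <= x <= pi / 2 -> 1 - 2 * x / pi <= cos x.
Proof.
move=> /andP[x0 xpi]; have pi0 := pi_gt0 R.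
rewrite leNgt; apply/negP => cx.
have {}x0 : 0 < x.
  rewrite lt_neqAle x0 andbT; apply/eqP => x0'; move: cx; rewrite -x0' cos0; lra.
have {}xpi : x < pi / 2.
  rewrite lt_neqAle xpi andbT; apply/eqP => xpi'; move: cx; rewrite xpi' cos_pihalf.
  have -> : 2 * (pi / 2) / pi = 1 :> R
    by move: pi0; move: (pi : R) => P P0; field; rewrite gt_eqF.
  by rewrite subrr ltxx.
have mvt (a b : R) : a < b -> exists2 c, a < c < b & cos b - cos a = - sin c * (b - a).
  move=> ab; have [c cI cE] := @MVT R cos (fun c => - sin c) a b ab
    (fun c _ => is_derive_cos c) (continuous_subspaceT (@continuous_cos R)).
  by exists c => //; move: cI; rewrite in_itv.
have [y /andP[y0 yx] yE] := mvt _ _ x0; have [z /andP[xz zpi] zE] := mvt _ _ xpi.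
have syz : sin y < sin z by rewrite ltr_sin ?in_itv/=; lra.
move: yE zE; rewrite cos0 cos_pihalf subr0 => yE zE.
have sy : 2 / pi < sin y.
  by rewrite -(ltr_pM2r x0) mulrAC; lra.
have : (2 / pi) * (pi / 2 - x) < sin z * (pi / 2 - x) by rewrite ltr_pM2r; lra.
have -> : 2 / pi * (pi / 2 - x) = 1 - 2 * x / pi
    by move: pi0; move: (pi : R) => P P0; field; rewrite gt_eqF.
lra.
Qed.

(** The vector (cos y, sin y, w y) lies on the cone w^2 = (kap cos y)^2 + (sin y)^2, and so is a
    positive multiple of (cos x, kap sin x, kap) for exactly one angle x.  All terms being forms
    of degree 2n in that vector, the multiple factors out and a trigonometric polynomial of degree
    2n in x remains. *)
Lemma arc_few_zeros n (kap S : R) (p : {poly R}) w :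
  0 < kap -> kap ^+ 2 + S ^+ 2 = 1 -> (size p <= n.*2.+1)%N ->
  (forall y, 0 < w y) -> (forall y, w y ^+ 2 = 1 - (S * cos y) ^+ 2) ->
  forall l c, few_zeros n.*2 (fun y =>
    cos (n.*2%:R * (y - c)) - l * (p.[S * cos y / w y] * w y ^+ n.*2)).
Proof.
move=> k0 kS sp w0 wE l c.
have kne : kap != 0 by rewrite gt_eqF.
have wne y : w y != 0 by rewrite gt_eqF.
have cone y : w y ^+ 2 = (kap * cos y) ^+ 2 + sin y ^+ 2.
  rewrite wE sin2cos2 !exprMn; have -> : kap ^+ 2 = 1 - S ^+ 2 by lra.
  ring.
have xE y : exists x, circle_pt x = (kap * cos y / w y, sin y / w y).
  have [|x _ xE] := @angle_exists _ (kap * cos y / w y) (sin y / w y); last by exists x.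
  by rewrite !expr_div_n -mulrDl -cone divff// expf_neq0.
have {xE}[x xE] := choice xE.
have cx y : cos (x y) = kap * cos y / w y by case: (xE y).
have sx y : sin (x y) = sin y / w y by case: (xE y).
have [h th hE] := trig_poly_ellipse kap n.*2 (cos (n.*2%:R * c)) (sin (n.*2%:R * c)).
(* G (x y) is (kap / w y)^(2n) times the function whose zeros are counted. *)
pose G t := h t + (- l * kap ^+ n.*2) * p.[0 + (S / kap * cos t + 0 * sin t)].
have tG : trig_poly n.*2 G.
  apply: trig_polyD => //; apply: trig_polyZ; apply: trig_poly_horner => //.
  by apply: trig_polyD; [exact: trig_poly_cst|exact: trig_poly_cos_sin].
have GE y : G (x y) = (kap / w y) ^+ n.*2 *
    (cos (n.*2%:R * (y - c)) - l * (p.[S * cos y / w y] * w y ^+ n.*2)).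
  rewrite /G (hE _ y (kap / w y)); last 2 first.
  - by rewrite cx mulrAC.
  - by rewrite sx mulrAC mulrA.
  have -> : 0 + (S / kap * cos (x y) + 0 * sin (x y)) = S * cos y / w y.
    by rewrite cx; field; rewrite wne.
  have -> : kap ^+ n.*2 = (kap / w y) ^+ n.*2 * w y ^+ n.*2.
    by rewrite -exprMn divfK.
  rewrite [n.*2%:R * (y - c)]mulrBr cosB.
  move: (n.*2%:R * y) (n.*2%:R * c) (_ ^+ n.*2) (w y ^+ n.*2) p.[_] => a b K W P.
  ring.
apply: (@few_zeros_transfer _ _ _ G x) (fun zs => trig_poly_zeros tG).
- move=> y z xyz.
  have [e1 e2] : kap * cos y / w y = kap * cos z / w z /\ sin y / w y = sin z / w z.
    by rewrite -!cx -!sx; case: xyz => -> ->.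
  have {}e1 : cos y / w y = cos z / w z.
    by apply: (mulfI kne); rewrite !mulrA.
  (* The factor w is recovered from the point because (cos y, sin y) has norm 1. *)
  have inv y' : (w y') ^- 2 = (cos y' / w y') ^+ 2 + (sin y' / w y') ^+ 2.
    by rewrite !expr_div_n -mulrDl cos2Dsin2 div1r.
  have wyz : w y = w z.
    apply/eqP; rewrite -(@eqrXn2 _ 2) ?ltW//; apply/eqP/invr_inj.
    by rewrite !inv e1 e2.
  by rewrite /circle_pt -[cos y](divfK (wne y)) -[sin y](divfK (wne y)) e1 e2 wyz !divfK.
- move=> y; rewrite GE; split=> [->|/eqP]; first by rewrite mulr0.
  rewrite mulf_eq0 expf_eq0 mulf_eq0 invr_eq0 (negbTE kne) (negbTE (wne y)) andbF /=.
  by move/eqP.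
Qed.

Lemma sin_le_inj (x y : R) : - (pi / 2) <= x <= pi / 2 -> - (pi / 2) <= y <= pi / 2 ->
  sin x <= sin y -> x <= y.
Proof.
by move=> xI yI; apply: contraTT; rewrite -!ltNge ltr_sin// in_itv.
Qed.

(** Measured from the midpoint, theta = 2 z y with sin (z y) = S cos y, where S is the sine of half
    the half-length of the arc; as y ranges over [0, pi], theta ranges over the arc.  A
    trigonometric polynomial g of degree n is a form of degree 2n in the sine and cosine of
    theta / 2, hence N = 2n in the comparison. *)
Lemma arc_nodes_inv_cos n M (m u v : R) : (0 < n)%N -> 1 < m -> 2 * m * n%:R <= M%:R ->
  0 < v - u < 2 * pi ->
  exists2 X : 'I_M.+1 -> R, forall k, u <= X k <= v &
    forall g, trig_poly n g -> forall t, u <= t <= v -> exists k,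
      `|g t| <= 1 / cos (pi / (2 * m)) * `|g (X k)|.
Proof.
move=> n0 m1 nM /andP[uv0 uv]; have pi0 := pi_gt0 R.
have n0' : 0 < n%:R :> R by rewrite ltr0n.
have M0' : 0 < M%:R :> R by rewrite (lt_le_trans _ nM)// !mulr_gt0//; lra.
have M0 : (0 < M)%N by rewrite -(ltr0n R).
pose om := (v - u) / 4; pose S := sin om; pose kap := cos om.
have om0 : 0 < om < pi / 2 by rewrite /om; lra.
have S0 : 0 < S by exact: sin_gt0_pihalf.
have k0 : 0 < kap by apply: cos_gt0_pihalf; lra.
have kS : kap ^+ 2 + S ^+ 2 = 1 by exact: cos2Dsin2.
have S1 : S < 1.
  rewrite ltNge; apply/negP => S1; have := exprn_gt0 2 k0.
  have : 1 * 1 <= S * S by apply: ler_pM.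
  by rewrite -expr2; lra.
have ScI y : -1 < S * cos y < 1.
  have := ler_wpM2l (ltW S0) (cos_le1 y); have := ler_wpM2l (ltW S0) (cos_geN1 y); lra.
pose z y := asin (S * cos y).
have sz y : sin (z y) = S * cos y by rewrite asinK// in_itv/=; have := ScI y; lra.
have zpi y : - (pi / 2) < z y < pi / 2.
  by rewrite asin_gtNpi2 ?asin_ltpi2//; have := ScI y; lra.
have om_itv : (- (pi / 2) <= - om <= pi / 2) && (- (pi / 2) <= om <= pi / 2).
  move: om0; clear; lra.
have /andP[om_itv1 om_itv2] := om_itv.
have zom y : - om <= z y <= om.
  have zI : - (pi / 2) <= z y <= pi / 2 by have /andP[/ltW-> /ltW->] := zpi y.
  have /andP[/ltW c1 /ltW c2] := ScI y.
  apply/andP; split; apply: sin_le_inj => //; rewrite sz ?sinN -/S.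
    by rewrite -[leLHS]mulrN1 ler_wpM2l ?cos_geN1// ltW.
  by rewrite -[leRHS]mulr1 ler_wpM2l ?cos_le1// ltW.
pose th y := (u + v) / 2 + 2 * z y.
have thI y : u <= th y <= v by have := zom y; rewrite /th /om; lra.
exists (fun k : 'I_M.+1 => th (k%:R * (pi / M%:R))) => // g tg t tI.
pose w y := cos (z y).
have w0 y : 0 < w y by apply: cos_gt0_pihalf.
have [p sp pE] := tg.2 ((u + v) / 2).
have gE y : g (th y) = p.[S * cos y / w y] * w y ^+ n.*2.
  have e : 2 * z y / 2 = z y by field.
  rewrite /th pE e; last by rewrite gt_eqF// w0.
  by rewrite /tan sz.
have fz l c : few_zeros n.*2 (fun y => cos (n.*2%:R * (y - c)) - l * (g \o th) y).
  have -> : g \o th = (fun y => p.[S * cos y / w y] * w y ^+ n.*2) by apply/funext.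
  by apply: (arc_few_zeros k0) => // y; rewrite /w cos2sin2 sz.
have cg : continuous (g \o th).
  move=> y; apply: continuous_comp; last exact: tg.1.
  apply: cvgD; first exact: cvg_cst.
  apply: cvgM; first exact: cvg_cst.
  apply: (@continuous_comp _ _ _ (fun y => S * cos y) asin); last exact: continuous_asin.
  by apply: cvgM; [exact: cvg_cst|exact: continuous_cos].
have fper x : exists2 x', 0 <= x' <= pi & (g \o th) x' = (g \o th) x.
  have cI : -1 <= cos x <= 1 by rewrite cos_geN1 cos_le1.
  exists (acos (cos x)); first by rewrite acos_ge0// acos_lepi.
  by rewrite /= /th /z acosK// in_itv.
have Nh : n.*2%:R * (pi / (2 * M%:R)) <= pi / (2 * m).
  rewrite -mul2n natrM mulrA ler_pdivrMr ?mulr_gt0// [pi / _ * _]mulrAC ler_pdivlMr; last lra.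
  have := ler_wpM2l (ltW pi0) nM; lra.
have n20 : (0 < n.*2)%N by rewrite double_gt0.
pose y := (t - (u + v) / 2) / 2.
have yI : - om <= y <= om by rewrite /y /om; lra.
have syI : -1 <= sin y / S <= 1.
  have y_itv : - (pi / 2) <= y <= pi / 2 by move: yI om_itv; clear; lra.
  rewrite ler_pdivlMr// ler_pdivrMr// mulN1r mul1r /S -sinN.
  by rewrite !leNgt !ltr_sin ?in_itv// -!leNgt.
have [k] := equispaced_sampling n20 M0 pi0 m1 cg fper fz Nh (acos (sin y / S)).
rewrite /= {1}/th /z acosK ?in_itv// [S * _]mulrC divfK ?gt_eqF//.
rewrite sinK ?in_itv/=; last lra.
have -> : (u + v) / 2 + 2 * y = t by rewrite /y; field.
by move=> kP; exists k.
Qed.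

Lemma inv_cos_gt1 (m : R) : 1 < m -> 1 < 1 / cos (pi / (2 * m)).
Proof.
move=> m1; have pi0 := pi_gt0 R.
have pm0 : 0 < pi / (2 * m) by rewrite divr_gt0//; lra.
have pm1 : pi / (2 * m) < pi / 2 by rewrite ltr_pM2l// ltf_pV2 ?posrE; lra.
have cm : 0 < cos (pi / (2 * m)) by apply: cos_gt0_pihalf; lra.
rewrite ltr_pdivlMr// mul1r -[ltRHS]cos0 ltr_cos ?in_itv/=; lra.
Qed.

Lemma inv_cos_le (m : R) : 1 < m -> 1 / cos (pi / (2 * m)) <= m / (m - 1).
Proof.
move=> m1; have pi0 := pi_gt0 R.
have pm0 : 0 < pi / (2 * m) by rewrite divr_gt0//; lra.
have pm1 : pi / (2 * m) < pi / 2 by rewrite ltr_pM2l// ltf_pV2 ?posrE; lra.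
have cm : 0 < cos (pi / (2 * m)) by apply: cos_gt0_pihalf; lra.
have := @cos_jordan (pi / (2 * m)).
have -> : 2 * (pi / (2 * m)) / pi = m^-1
    by move: pi0; move: (pi : R) => P P0; field; rewrite !gt_eqF//; lra.
have -> : m / (m - 1) = 1 / (1 - m^-1) by field; rewrite !gt_eqF//; lra.
have : m^-1 < 1 by rewrite invf_lt1//; lra.
move=> mV h; rewrite !div1r lef_pV2 ?posrE//; last lra.
apply: h; lra.
Qed.

Lemma arc_nodes n M (m u v : R) : (0 < n)%N -> 1 < m -> 2 * m * n%:R <= M%:R ->
  0 < v - u < 2 * pi ->
  exists2 X : 'I_M.+1 -> R, forall k, u <= X k <= v &
    forall g, trig_poly n g -> forall t, u <= t <= v -> exists k,
      `|g t| <= m / (m - 1) * `|g (X k)|.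
Proof.
move=> n0 m1 nM uv; have [X XI XP] := arc_nodes_inv_cos n0 m1 nM uv.
exists X => // g tg t tI; have [k kP] := XP g tg t tI; exists k.
by rewrite (le_trans kP)// ler_wpM2r// inv_cos_le.
Qed.

End Arc.

(** * Functions of several linear and angular variables *)

Section AlgPoly.
Context {R : realType}.
Implicit Types (g : R -> R) (n : nat).

Lemma alg_poly_cst n (c : R) : alg_poly n (fun=> c).
Proof.
by exists c%:P => [|x]; rewrite ?hornerC// (leq_trans (size_polyC_leq1 _)).
Qed.

Lemma alg_polyD n g1 g2 : alg_poly n g1 -> alg_poly n g2 ->
  alg_poly n (fun x => g1 x + g2 x).
Proof.
move=> [p1 s1 e1] [p2 s2 e2]; exists (p1 + p2) => [|x]; last by rewrite hornerD e1 e2.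
by rewrite (leq_trans (size_polyD _ _))// geq_max s1.
Qed.

Lemma alg_polyM n1 n2 g1 g2 : alg_poly n1 g1 -> alg_poly n2 g2 ->
  alg_poly (n1 + n2) (fun x => g1 x * g2 x).
Proof.
move=> [p1 s1 e1] [p2 s2 e2]; exists (p1 * p2) => [|x]; last by rewrite hornerM e1 e2.
by rewrite (leq_trans (size_polyMleq _ _))//; lia.
Qed.

Lemma alg_poly_widen n1 n2 g : (n1 <= n2)%N -> alg_poly n1 g -> alg_poly n2 g.
Proof. by move=> n12 [p sp pE]; exists p => //; rewrite (leq_trans sp). Qed.

(** Elements of the space are extended by 0, hence discontinuous; this gives the continuous
    extension. *)
Lemma trig_space_ext n (u v : R) g : trig_space n u v g ->
  exists2 T, trig_poly n T & forall x, u <= x <= v -> g x = T x.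
Proof.
move=> [k [c [e [eE ->]]]].
have tE i : exists T, trig_poly n T /\ forall x, u <= x <= v -> e i x = T x.
  have mult l (A B : R) : (l <= n)%N ->
      trig_poly n (fun x => A * cos (l%:R * x) + B * sin (l%:R * x)).
    move=> ln; have [h th hE] := trig_poly_ellipse 1 l A B.
    apply: (trig_poly_widen ln); congr trig_poly: th.
    by apply/funext => x; rewrite (hE x x 1) ?mul1r// expr1n mul1r.
  case: (eE i) => -[l /= ln <-].
    exists (fun x => 1 * cos (l%:R * x) + 0 * sin (l%:R * x)); split; first exact: mult.
    by move=> x xI; rewrite patchE mem_set ?mul1r ?mul0r ?addr0//= in_itv.
  exists (fun x => 0 * cos (l%:R * x) + 1 * sin (l%:R * x)); split; first exact: mult.
  by move=> x xI; rewrite patchE mem_set ?mul1r ?mul0r ?add0r//= in_itv.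
have {tE}[T tT] := choice tE.
exists (fun x => \sum_i c i * T i x).
  by apply: trig_poly_sum => i; apply: trig_polyZ; case: (tT i).
by move=> x xI; rewrite fct_sumE; apply: eq_bigr => i _; rewrite fctE (tT i).2.
Qed.

End AlgPoly.

(** Each coordinate that is moved to a node costs its constant, and stays at this node while the
    other coordinates are moved. *)
Lemma coordinatewise_sampling (R : realType) (J : finType) (F : (J -> R) -> R)
    (B N : J -> set R) (c : J -> R) :
  (forall j, 0 <= c j) -> (forall j, N j `<=` B j) ->
  (forall j z, (forall i, B i (z i)) -> exists2 y, N j y &
     `|F z| <= c j * `|F (fun i => if i == j then y else z i)|) ->
  forall z, (forall i, B i (z i)) -> exists2 z', (forall i, N i (z' i)) &
    `|F z| <= (\prod_j c j) * `|F z'|.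
Proof.
move=> c0 NB step z zB.
suff [z' [_ z'N z'F]] : exists z', [/\ forall i, B i (z' i),
    forall i, i \in index_enum J -> N i (z' i) & `|F z| <= (\prod_j c j) * `|F z'|].
  by exists z' => // i; apply: z'N; rewrite mem_index_enum.
elim: (index_enum J) => [|j s [z' [z'B z'N z'F]]].
  by exists z; split=> //; rewrite big_nil mul1r.
have [y yN yF] := step j z' z'B.
exists (fun i => if i == j then y else z' i); split=> [i|i|].
- by case: eqP => [->|_] //; exact: NB.
- by rewrite in_cons; case: eqP => [->|_ /=] // /z'N.
- rewrite big_cons (le_trans z'F)// [c j * _]mulrC -mulrA ler_wpM2l//.
  exact: prodr_ge0.
Qed.

Section Multi.
Context {R : realType} {d1 D : nat}.
Notation J := ('I_d1 + 'I_D)%type.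
Notation X := ('rV[R]_d1 * 'rV[R]_D)%type.
Implicit Types (F : X -> R) (e : J -> nat) (z : J -> R).

Definition point_of z : X := (\row_i z (inl i), \row_j z (inr j)).

Definition coord_of (x : X) (j : J) : R :=
  match j with inl i => x.1 ord0 i | inr i => x.2 ord0 i end.

Lemma coord_ofK x : point_of (coord_of x) = x.
Proof. by case: x => x y; congr pair; apply/rowP => i; rewrite mxE. Qed.

Lemma point_ofK z : coord_of (point_of z) = z.
Proof. by apply/funext => -[i|i]; rewrite /= mxE. Qed.

Definition update z j y : J -> R := fun i => if i == j then y else z i.

Definition section_poly (j : J) n : (R -> R) -> Prop :=
  if j is inl _ then alg_poly n else trig_poly n.

(** The degree bound is allowed to depend on the coordinate because the product of functions of
    distinct coordinates has degree 1, and no more, in each. *)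
Definition multi_poly e F : Prop :=
  continuous F /\
  forall z j, section_poly j (e j) (fun y => F (point_of (update z j y))).

Lemma coord_cont j : continuous (coord_of^~ j).
Proof.
case: j => i x /=.
  apply: (@continuous_comp _ _ _ fst (fun M : 'rV[R]_d1 => M ord0 i)).
    exact: cvg_fst.
  exact: coord_continuous.
apply: (@continuous_comp _ _ _ snd (fun M : 'rV[R]_D => M ord0 i)).
  exact: cvg_snd.
exact: coord_continuous.
Qed.

Lemma multi_poly_cst e (c : R) : multi_poly e (fun=> c).
Proof.
split=> [x|z [i|i]]; [exact: cvg_cst|exact: alg_poly_cst|exact: trig_poly_cst].
Qed.

Lemma multi_polyD e F1 F2 : multi_poly e F1 -> multi_poly e F2 ->
  multi_poly e (fun x => F1 x + F2 x).
Proof.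
move=> [c1 s1] [c2 s2]; split=> [x|z [i|i]].
- by apply: cvgD; [exact: c1|exact: c2].
- exact: alg_polyD (s1 z (inl i)) (s2 z (inl i)).
- exact: trig_polyD (s1 z (inr i)) (s2 z (inr i)).
Qed.

Lemma multi_polyM e1 e2 F1 F2 : multi_poly e1 F1 -> multi_poly e2 F2 ->
  multi_poly (fun j => e1 j + e2 j)%N (fun x => F1 x * F2 x).
Proof.
move=> [c1 s1] [c2 s2]; split=> [x|z [i|i]].
- by apply: cvgM; [exact: c1|exact: c2].
- exact: alg_polyM (s1 z (inl i)) (s2 z (inl i)).
- exact: trig_polyM (s1 z (inr i)) (s2 z (inr i)).
Qed.

Lemma multi_poly_widen e1 e2 F : (forall j, e1 j <= e2 j)%N ->
  multi_poly e1 F -> multi_poly e2 F.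
Proof.
move=> e12 [c1 s1]; split=> // z [i|i].
- exact: alg_poly_widen (e12 _) (s1 z (inl i)).
- exact: trig_poly_widen (e12 _) (s1 z (inr i)).
Qed.

Lemma multi_poly_sum e (I : eqType) (s : seq I) (F : I -> X -> R) :
  (forall i, i \in s -> multi_poly e (F i)) ->
  multi_poly e (fun x => \sum_(i <- s) F i x).
Proof.
elim: s => [|i s IH] sF.
  by under [X in multi_poly _ X]eq_fun do rewrite big_nil; exact: multi_poly_cst.
under [X in multi_poly _ X]eq_fun do rewrite big_cons.
apply: multi_polyD; first by apply: sF; rewrite mem_head.
by apply: IH => j js; apply: sF; rewrite in_cons js orbT.
Qed.

Lemma multi_poly_prod (I : Type) (s : seq I) (e : I -> J -> nat) (F : I -> X -> R) :
  (forall i, multi_poly (e i) (F i)) ->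
  multi_poly (fun j => \sum_(i <- s) e i j)%N (fun x => \prod_(i <- s) F i x).
Proof.
move=> sF; elim: s => [|i s IH].
  by under [X in multi_poly _ X]eq_fun do rewrite big_nil; exact: multi_poly_cst.
under [X in multi_poly _ X]eq_fun do rewrite big_cons.
apply: multi_poly_widen (multi_polyM (sF i) IH) => j; rewrite big_cons//.
Qed.

Lemma multi_polyX e k F : multi_poly e F ->
  multi_poly (fun j => k * e j)%N (fun x => F x ^+ k).
Proof.
move=> tF; elim: k => [|k IH]; first exact: multi_poly_cst.
by under [X in multi_poly _ X]eq_fun do rewrite exprS; exact: multi_polyM.
Qed.

Lemma multi_poly_coord (j : J) g : section_poly j 1 g ->
  multi_poly (fun i => i == j : nat) (fun x => g (coord_of x j)).
Proof.
move=> sg; split=> [x|z i].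
  apply: (@continuous_comp _ _ _ (coord_of^~ j) g); first exact: coord_cont.
  case: j sg => j /= [].
    by move=> p _ /funext ->; exact: continuous_horner.
  by move=> cg _; exact: cg.
have [->|ij] := eqVneq i j.
  have -> : (fun y => g (coord_of (point_of (update z j y)) j)) = g.
    by apply/funext => y; rewrite point_ofK /update eqxx.
  exact: sg.
have -> : (fun y => g (coord_of (point_of (update z i y)) j)) = fun=> g (z j).
  by apply/funext => y; rewrite point_ofK /update eq_sym (negbTE ij).
by case: i ij => i _; [exact: alg_poly_cst|exact: trig_poly_cst].
Qed.

(** An element of the tensor product agrees on the box with a function that is continuous and
    polynomial on the whole space. *)
Lemma tensor_multi_poly (a b : 'I_d1 -> R) (u v : 'I_D -> R) (f : X -> R) :
  tensor_space (fun i => poly_space 1 (a i) (b i)) (fun j => trig_space 1 (u j) (v j)) f ->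
  exists2 F, multi_poly (fun=> 1%N) F & forall x, (box a b `*` box u v) x -> f x = F x.
Proof.
move=> [k [c [e [eE ->]]]].
have FE i : exists F, multi_poly (fun=> 1%N) F /\
    forall x, (box a b `*` box u v) x -> e i x = F x.
  have [p [g [pE gE ->]]] := eE i.
  have qE j : exists q, alg_poly 1 q /\ forall y, a j <= y <= b j -> p j y = q y.
    have [q sq <-] := pE j; exists (horner q); split; first by exists q.
    by move=> y yI; rewrite patchE mem_set//= in_itv.
  have {qE}[q qE] := choice qE.
  have TE j : exists T, trig_poly 1 T /\ forall y, u j <= y <= v j -> g j y = T y.
    by have [T ? ?] := trig_space_ext (gE j); exists T.
  have {TE}[T TE] := choice TE.
  exists (fun x : X => (\prod_j q j (x.1 ord0 j)) * (\prod_j T j (x.2 ord0 j))); split.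
    have mq := @multi_poly_prod _ (index_enum 'I_d1) _ _
      (fun j => @multi_poly_coord (inl j) _ (qE j).1).
    have mT := @multi_poly_prod _ (index_enum 'I_D) _ _
      (fun j => @multi_poly_coord (inr j) _ (TE j).1).
    apply: multi_poly_widen (multi_polyM mq mT) => -[j|j].
      rewrite [X in (_ + X)%N]big1// addn0 (bigD1 j)//= eqxx big1// => l lj.
      by rewrite (inj_eq (@inl_inj _ _)) eq_sym (negbTE lj).
    rewrite [X in (X + _)%N]big1// add0n (bigD1 j)//= eqxx big1// => l lj.
    by rewrite (inj_eq (@inr_inj _ _)) eq_sym (negbTE lj).
  move=> x [/= x1 x2]; congr (_ * _); apply: eq_bigr => j _.
    exact: (qE j).2.
  exact: (TE j).2.
have {FE}[F FE] := choice FE.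
exists (fun x => \sum_i c i * F i x).
  apply: multi_poly_sum => i _.
  exact: multi_poly_widen (multi_polyM (multi_poly_cst (fun=> 0%N) (c i)) (FE i).1).
by move=> x xI; rewrite fct_sumE; apply: eq_bigr => i _; rewrite fctE (FE i).2.
Qed.

(** The total degree of p bounds the degree in each coordinate, as each F l has degree 1. *)
Lemma multi_poly_meval d n (F : 'I_d -> X -> R) (p : mpoly.mpoly d R) :
  (mpoly.msize p <= n.+1)%N -> (forall l, multi_poly (fun=> 1%N) (F l)) ->
  multi_poly (fun=> n) (fun x => mpoly.meval (F^~ x) p).
Proof.
move=> sp mF; under [X in multi_poly _ X]eq_fun do rewrite mpoly.mevalE.
apply: multi_poly_sum => m mp.
have mn : (mpoly.mdeg m <= n)%N.
  by rewrite -ltnS (leq_trans (mpoly.msize_mdeg_lt mp)).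
have mprod := @multi_poly_prod _ (index_enum 'I_d) _ _ (fun l => multi_polyX (m l) (mF l)).
apply: multi_poly_widen (multi_polyM (multi_poly_cst (fun=> 0%N) _) mprod) => j.
rewrite add0n (leq_trans _ mn)// mpoly.mdegE; apply: leq_sum => l _.
by rewrite muln1.
Qed.

Lemma section_poly_continuous (j : J) n (g : R -> R) :
  section_poly j n g -> continuous g.
Proof.
case: j => j [] //.
by move=> p _ /funext ->; exact: continuous_horner.
Qed.

Context (a b : 'I_d1 -> R) (u v : 'I_D -> R).

Definition lower (j : J) : R := match j with inl i => a i | inr i => u i end.
Definition upper (j : J) : R := match j with inl i => b i | inr i => v i end.

Lemma box_coord (x : X) : (box a b `*` box u v) x <->
  forall j, lower j <= coord_of x j <= upper j.
Proof.
split=> [[/= x1 x2] [i|i]|xB]; [exact: x1|exact: x2|].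
by split=> i /=; [exact: (xB (inl i))|exact: (xB (inr i))].
Qed.

Lemma box_point_of z : (box a b `*` box u v) (point_of z) <->
  forall j, lower j <= z j <= upper j.
Proof. by rewrite box_coord point_ofK. Qed.

(** If F were constant along each coordinate direction inside the box, it would be constant.
    So some section takes two values, and by continuity all values in between. *)
Lemma multi_poly_values e F (x0 x1 : X) : multi_poly e F ->
  (box a b `*` box u v) x0 -> (box a b `*` box u v) x1 -> F x1 != F x0 ->
  exists v0 v1, v0 < v1 /\ forall y, v0 <= y <= v1 ->
    exists2 x, (box a b `*` box u v) x & F x = y.
Proof.
move=> [cF sF] /box_coord x0B /box_coord x1B; apply: contra_neqP => noval.
have step j z : (forall i, lower i <= z i <= upper i) ->
    F (point_of z) = F (point_of (update z j (coord_of x0 j))).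
  move=> zB; apply: contrapT => /eqP Fz; apply: noval.
  pose g y := F (point_of (update z j y)).
  have cg : continuous g := section_poly_continuous (sF z j).
  have gz : g (z j) = F (point_of z).
    by congr (F (point_of _)); apply/funext => i; rewrite /update; case: eqP => [->|].
  have val p q y : p <= q -> lower j <= p -> q <= upper j ->
      Num.min (g p) (g q) <= y <= Num.max (g p) (g q) ->
      exists2 x, (box a b `*` box u v) x & F x = y.
    move=> pq lp qu gy; have [|t tI gt] := IVT pq _ gy; first exact: continuous_subspaceT.
    exists (point_of (update z j t)) => //; apply/box_point_of => i.
    rewrite /update; case: eqP => // ->.
    by move: tI; rewrite in_itv/= => /andP[pt tq]; rewrite (le_trans lp)// (le_trans tq).
  have /andP[zl zu] := zB j; have /andP[xl xu] := x0B j.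
  have {}val y : Num.min (g (z j)) (g (coord_of x0 j)) <= y
      <= Num.max (g (z j)) (g (coord_of x0 j)) ->
      exists2 x, (box a b `*` box u v) x & F x = y.
    have [zx|/ltW xz] := leP (z j) (coord_of x0 j) => yI; first exact: val zx zl xu yI.
    by apply: val xz xl zu _; rewrite minC maxC.
  have [lt|gt|eq] := ltgtP (g (z j)) (g (coord_of x0 j)).
  - exists (g (z j)), (g (coord_of x0 j)); split=> // y /andP[y1 y2].
    by apply: val; rewrite ge_min le_max y1 y2 orbT.
  - exists (g (coord_of x0 j)), (g (z j)); split=> // y /andP[y1 y2].
    by apply: val; rewrite ge_min le_max y1 y2 orbT.
  - by move: Fz; rewrite -gz eq eqxx.
(* Sampling F - F x0 with x0 as the only node and all constants equal to 1. *)
have [||||z' z'E] := @coordinatewise_sampling R J (fun z => F (point_of z) - F x0)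
  (fun j => [set y | lower j <= y <= upper j]) (fun j => [set coord_of x0 j])
  (fun=> 1) _ _ _ (coord_of x1).
- by move=> _; exact: ler01.
- by move=> j _ ->; exact: x0B.
- by move=> j z zB; exists (coord_of x0 j) => //; rewrite mul1r (step j z zB).
- exact: x1B.
have -> : z' = coord_of x0 by apply/funext.
by rewrite !coord_ofK subrr normr0 mulr0 normr_le0 subr_eq0 => /eqP.
Qed.

End Multi.

(** * Dimension of polynomial spaces *)

Section Dimension.
Context {F : fieldType} {V : lmodType F}.
Implicit Types (W : set V).

Lemma lspan_rangeP k (e : 'I_k -> V) v :
  lspan (range e) v <-> exists c : 'I_k -> F, v = \sum_i c i *: e i.
Proof.
split=> [[l [c [f [fE ->]]]]|[c ->]]; last by exists k, c, e; split=> // i; exists i.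
have gE i : exists j, e j = f i by have [j _ <-] := fE i; exists j.
have {gE}[g gE] := choice gE.
exists (fun j => \sum_(i | g i == j) c i).
rewrite (partition_big g predT)//=; apply: eq_bigr => j _.
by rewrite scaler_suml; apply: eq_bigr => i /eqP <-; rewrite gE.
Qed.

(** As long as there is a non-trivial relation, a vector with a non-zero coefficient in it can
    be dropped. *)
Lemma span_basis k (e : 'I_k -> V) : exists k' (e' : 'I_k' -> V),
  lfree e' /\ lspan (range e') = lspan (range e).
Proof.
elim: k e => [|k IH] e.
  by exists 0%N, e; split=> // c _ [].
have [fe|] := pselect (lfree e); first by exists k.+1, e.
move=> /existsNP[c /not_implyP[c0 /existsNP[i /eqP ci]]].
have [k' [e' [fe' e'E]]] := IH (e \o lift i); exists k', e'; split=> //.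
rewrite {}e'E; apply/seteqP; split=> v /lspan_rangeP[b ->]; apply/lspan_rangeP.
  exists (fun j => if unlift i j is Some l then b l else 0).
  rewrite (bigD1_ord i)//= unlift_none scale0r add0r.
  by apply: eq_bigr => l _; rewrite liftK.
have ei : e i = - \sum_l ((c i)^-1 * c (lift i l)) *: e (lift i l).
  move: c0; rewrite (bigD1_ord i)//= => /eqP; rewrite addr_eq0 => /eqP c0.
  apply: (scalerI ci); rewrite c0 scalerN scaler_sumr; congr (- _).
  by apply: eq_bigr => l _; rewrite scalerA mulrA divff// mul1r.
exists (fun l => b (lift i l) - b i * ((c i)^-1 * c (lift i l))).
rewrite (bigD1_ord i)//= ei scalerN scaler_sumr -sumrN -big_split /=.
by apply: eq_bigr => l _; rewrite scalerBl scalerA addrC.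
Qed.

(** Steinitz: the matrix of the coefficients of f on e has independent rows, so at most as many
    rows as columns. *)
Lemma lfree_span_le k p (e : 'I_k -> V) (f : 'I_p -> V) :
  lfree f -> (forall i, lspan (range e) (f i)) -> (p <= k)%N.
Proof.
move=> ff fe; have cE i : exists c : 'I_k -> F, f i = \sum_j c j *: e j.
  exact/lspan_rangeP.
have {cE}[c cE] := choice cE.
pose M := \matrix_(i < p, j < k) c i j.
suff /eqP <- : row_free M by exact: rank_leq_col.
rewrite -kermx_eq0; apply/eqP/row_matrixP => r; rewrite row0.
set w := row r (kermx M).
have wM : w *m M = 0 by rewrite -row_mul mulmx_ker row0.
apply/rowP => i; rewrite [RHS]mxE; apply: (ff (fun i => w ord0 i)).
rewrite (eq_bigr (fun i => \sum_j (w ord0 i * M i j) *: e j)); last first.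
  move=> l _; rewrite cE scaler_sumr; apply: eq_bigr => j _.
  by rewrite scalerA [M _ _]mxE.
rewrite exchange_big big1//= => j _; rewrite -scaler_suml.
have := congr1 (fun A : 'rV_k => A ord0 j) wM; rewrite !mxE => ->.
by rewrite scale0r.
Qed.

(** The finite spanning family e is there because the dimension takes a dummy value otherwise. *)
Lemma ldim_ge W k (e : 'I_k -> V) p (f : 'I_p -> V) :
  W = lspan (range e) -> lfree f -> (forall i, W (f i)) -> (p <= ldim W)%N.
Proof.
move=> WE ff Wf.
have [e' [fe' e'E]] : [set k | exists e : 'I_k -> V, lfree e /\ lspan (range e) = W] (ldim W).
  by apply: xgetPex; have [k' [e' [fe' e'E]]] := span_basis e; exists k', e'; rewrite WE.
by apply: (@lfree_span_le _ _ e' f) => //; rewrite e'E.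
Qed.

End Dimension.

Section PolynomialSpace.
Context {R : realType} {d : nat}.
Implicit Types (K : set 'rV[R]_d) (n : nat).

Lemma mpoly_space_span n K : exists k (e : 'I_k -> 'rV[R]_d -> R),
  mpoly_space n K = lspan (range e).
Proof.
pose T : finType := mpoly.bmultinom d n.+1.
pose mon (m : T) : mpoly.mpoly d R := mpoly.mpolyX R (mpoly.bmnm m).
pose e (i : 'I_#|T|) := (fun x : 'rV[R]_d => mpoly.meval (x ord0) (mon (enum_val i))) \_ K.
have combE (c : T -> R) : (fun x : 'rV[R]_d => mpoly.meval (x ord0) (\sum_m c m *: mon m)) \_ K =
    \sum_i c (enum_val i) *: e i.
  rewrite (reindex (@enum_val T T)) /=; last first.
    by apply: onW_bij; exact: enum_val_bij.
  apply/funext => x; rewrite fct_sumE patchE; case: ifPn => xK.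
    rewrite raddf_sum; apply: eq_bigr => i _.
    by rewrite fctE /e patchE xK /= mpoly.mevalZ.
  by rewrite big1// => i _; rewrite fctE /e patchE (negbTE xK) scaler0.
exists #|T|, e; apply/seteqP; split=> f.
  move=> [p /= sp <-]; apply/lspan_rangeP.
  exists (fun i => mpoly.mcoeff (mpoly.bmnm (enum_val i)) p).
  rewrite -(combE (fun m => mpoly.mcoeff (mpoly.bmnm m) p)).
  by rewrite [in LHS](mpoly.mpolywE sp).
move=> /lspan_rangeP[c ->].
exists (\sum_m c (enum_rank m) *: mon m) => /=.
  rewrite (leq_trans (mpoly.msize_sum _ _ _))//; apply/bigmax_leqP => m _.
  by rewrite (leq_trans (mpoly.msizeZ_le _ _))// mpoly.msizeX mpoly.bmdeg.
by rewrite combE; apply: eq_bigr => i _; rewrite enum_valK.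
Qed.

Lemma ldim_mpoly_space_gt0 n K : K !=set0 -> (0 < ldim (mpoly_space n K))%N.
Proof.
move=> [x xK]; have [k [e eE]] := mpoly_space_span n K.
apply: (ldim_ge (f := fun _ : 'I_1 => (fun _ : 'rV[R]_d => 1 : R) \_ K) eE).
  move=> c; rewrite big_ord1 => /(congr1 (fun f => f x)).
  by rewrite fctE patchE mem_set// => c0 i; rewrite ord1 -[LHS]mulr1.
move=> _; exists 1; first by rewrite /= mpoly.msize1.
by congr (_ \_ K); apply/funext => y; rewrite mpoly.meval1.
Qed.

(** A relation between the powers 0, ..., n of a coordinate is a polynomial of degree n that
    vanishes at all the values of this coordinate on K. *)
Lemma ldim_mpoly_space_gt n K (l : 'I_d) (ts : seq R) :
  uniq ts -> (n < size ts)%N -> (forall t, t \in ts -> exists2 x, K x & x ord0 l = t) ->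
  (n < ldim (mpoly_space n K))%N.
Proof.
move=> uts sts tsK; have [k [e eE]] := mpoly_space_span n K.
apply: (ldim_ge (f := fun i : 'I_n.+1 => (fun x : 'rV[R]_d => x ord0 l ^+ i) \_ K) eE).
  move=> c c0; pose p := \poly_(i < n.+1) c (inord i).
  have p0 : p = 0.
    apply: (roots_geq_poly_eq0 _ uts); last by rewrite (leq_trans (size_poly _ _)).
    apply/allP => t /tsK[x xK <-]; apply/rootP.
    move: c0 => /(congr1 (fun f => f x)); rewrite fct_sumE => c0; apply: etrans c0.
    rewrite horner_poly; apply: eq_bigr => i _.
    by rewrite inord_val fctE patchE mem_set.
  move=> i; have := congr1 (fun q : {poly R} => q`_i) p0.
  by rewrite coef0 coef_poly ltn_ord inord_val.
move=> i; exists (mpoly.mpolyX R (mpoly.mnm1 l) ^+ i).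
  by rewrite /= mpoly.mpolyXn mpoly.msizeX mpoly.mdegMn mpoly.mdeg1 mul1n.
by congr (_ \_ K); apply/funext => x; rewrite rmorphXn /= mpoly.mevalXU.
Qed.

End PolynomialSpace.

Lemma bigO_le (R : realType) (f g : nat -> R) (C : R) : 0 < C ->
  (forall n, (0 < n)%N -> `|f n| <= C * `|g n|) -> f =O_\oo g.
Proof.
move=> C0 fg; apply/eqO_exP; exists C => //; near=> n; apply: fg.
by near: n; exists 1%N.
Unshelve. all: by end_near.
Qed.

(** * The mesh *)

Lemma continuous_row (R : realType) (T : topologicalType) d (F : 'I_d -> T -> R) :
  (forall l, continuous (F l)) -> continuous (fun x => \row_l F l x : 'rV[R]_d).
Proof.
move=> cF x; apply/cvg_ballP => e e0.
have : \forall y \near x, forall l, ball (F l x) e (F l y).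
  by apply: filter_forall => l; apply: cF; exact: nbhsx_ballx.
apply: filterS => y Fy; split=> // i j; rewrite !mxE; exact: Fy.
Qed.

(** M is the number of subdivisions, M.+1 that of the nodes. *)
Lemma ceil_succ (R : realType) (x : R) : 0 <= x ->
  exists2 M : nat, x <= M%:R & Num.ceil (x + 1) = M.+1%:Z.
Proof.
move=> x0; have := ceil_gt0 (x + 1); rewrite ltr_wpDl// => c0.
have cE : Num.ceil (x + 1) = (`|Num.ceil (x + 1)|%N.-1).+1%:Z.
  by rewrite prednK ?absz_gt0 ?gt_eqF// gtz0_abs.
exists `|Num.ceil (x + 1)|%N.-1 => //.
by have := ceil_ge (x + 1); rewrite {1}cE -pmulrn -natr1 lerD2r.
Qed.

Section Supnorm.
Context {R : realType} {T : choiceType}.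

Lemma supnorm_le (K A : set T) (f : T -> R) (c : R) :
  K !=set0 -> has_ubound [set `|f x| | x in A] -> 0 <= c ->
  (forall x, K x -> exists2 y, A y & `|f x| <= c * `|f y|) ->
  supnorm K f <= c * supnorm A f.
Proof.
move=> K0 Aub c0 KA; apply: ge_sup; first exact: image_nonempty.
move=> _ [x xK <-]; have [y yA yx] := KA x xK.
rewrite (le_trans yx)// ler_wpM2l//; apply: ub_le_sup => //.
by exists y.
Qed.

Lemma fset_has_ubound (A : {fset T}) (f : T -> R) :
  has_ubound [set `|f x| | x in [set` A]].
Proof.
exists (\sum_(x <- A) `|f x|) => _ [x /= xA <-].
by rewrite (big_rem x)//= lerDl sumr_ge0.
Qed.

End Supnorm.

Lemma prod_coordinate_constants (R : realType) (d1 d2 d3 : nat) (alpha beta : R) :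
  \prod_(j : 'I_d1 + 'I_(d2 + d3))
    (if j is inr i then if (i < d2)%N then alpha else beta else alpha) =
  alpha ^+ (d1 + d2) * beta ^+ d3.
Proof.
rewrite big_sumType /= prodr_const card_ord big_split_ord /=.
rewrite exprD -mulrA; congr (_ * (_ * _)).
  by rewrite (eq_bigr (fun=> alpha)) => [|i _]; rewrite ?prodr_const ?card_ord// ltn_ord.
rewrite (eq_bigr (fun=> beta)) => [|i _]; first by rewrite prodr_const card_ord.
by rewrite ltnNge leq_addr.
Qed.

Section Mesh.
Context {R : realType} {d d1 d2 d3 : nat}.
Context (a b : 'I_d1 -> R) (u v : 'I_(d2 + d3) -> R) (m : R).
Notation X := ('rV[R]_d1 * 'rV[R]_(d2 + d3))%type.
Context (F : 'I_d -> X -> R).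
Context (ab : forall i, a i < b i).
Context (uv_circle : forall j : 'I_(d2 + d3), (j < d2)%N -> v j - u j = 2 * pi).
Context (uv_arc : forall j : 'I_(d2 + d3), (d2 <= j)%N -> 0 < v j - u j < 2 * pi).
Context (m1 : 1 < m).
Context (mF : forall l, multi_poly (fun=> 1%N) (F l)).

Let B : set X := box a b `*` box u v.
Let K : set 'rV[R]_d := [set \row_l F l x | x in B].
Let alpha := 1 / cos (pi / (2 * m)).
Let beta := m / (m - 1).

Lemma angular_nodes n M (j : 'I_(d2 + d3)) : (0 < n)%N -> 2 * m * n%:R <= M%:R ->
  exists X : 'I_M.+1 -> R, (forall k, u j <= X k <= v j) /\
    forall g, trig_poly n g -> forall t, u j <= t <= v j -> exists k,
      `|g t| <= (if (j < d2)%N then alpha else beta) * `|g (X k)|.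
Proof.
move=> n0 nM; case: ltnP => jd.
  by have [Y YI YP] := circle_nodes n0 m1 nM (uv_circle jd); exists Y.
by have [Y YI YP] := arc_nodes n0 m1 nM (uv_arc jd); exists Y.
Qed.

Lemma box_nonempty : B !=set0.
Proof.
exists (\row_i a i, \row_j u j); split=> i; rewrite /= mxE lexx ltW//=.
have pi0 := pi_gt0 R; case: (ltnP i d2) => [/uv_circle|/uv_arc/andP[]]; lra.
Qed.

Lemma compact_image : compact K.
Proof.
apply: (@continuous_compact _ _ (fun x : X => \row_l F l x)).
  exact: (continuous_subspaceT (continuous_row (fun l => (mF l).1))).
have box_compact k (p q : 'I_k -> R) : compact (box p q).
  have -> : box p q = [set x | forall i, `[p i, q i]%classic (x ord0 i)].
    by apply/seteqP; split=> x xI i; have := xI i; rewrite /= in_itv.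
  exact: (@rV_compact _ _ (fun i => `[p i, q i]%classic) (fun i => @segment_compact _ _ _)).
exact: compact_setX.
Qed.

(** The image of the grid of all univariate nodes; its cardinality is bounded by that of the
    index set of the grid, as several nodes may have the same image. *)
Lemma mesh_exists n : (0 < n)%N ->
  exists A : {fset 'rV[R]_d}, [/\ [set` A] `<=` K,
    #|` A|%:Z <= Num.ceil (m * n%:R + 1) ^+ d1 *
                 Num.ceil (2 * m * n%:R + 1) ^+ (d2 + d3) &
    forall p, mpoly_space n K p ->
      supnorm K p <= alpha ^+ (d1 + d2) * beta ^+ d3 * supnorm [set` A] p].
Proof.
move=> n0; have m0 : 0 <= m by rewrite ltW// (lt_trans ltr01).
have [M1 mM1 ->] : exists2 M, m * n%:R <= M%:R & Num.ceil (m * n%:R + 1) = M.+1%:Z.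
  by apply: ceil_succ; rewrite mulr_ge0 ?ler0n.
have [M2 mM2 ->] : exists2 M, 2 * m * n%:R <= M%:R &
    Num.ceil (2 * m * n%:R + 1) = M.+1%:Z.
  by apply: ceil_succ; rewrite !mulr_ge0 ?ler0n.
have XE i : exists Y : 'I_M1.+1 -> R, (forall k, a i <= Y k <= b i) /\
    forall g, alg_poly n g -> forall t, a i <= t <= b i -> exists k,
      `|g t| <= alpha * `|g (Y k)|.
  by have [Y YI YP] := alg_nodes n0 m1 mM1 (ab i); exists Y.
have {XE}[Y YP] := choice XE.
have {}[Z ZP] := choice (fun j => angular_nodes j n0 mM2).
pose T : finType := ({ffun 'I_d1 -> 'I_M1.+1} * {ffun 'I_(d2 + d3) -> 'I_M2.+1})%type.
pose node (t : T) : X := (\row_i Y i (t.1 i), \row_j Z j (t.2 j)).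
have nodeB t : B (node t).
  by split=> i; rewrite /= mxE; [exact: (YP i).1|exact: (ZP i).1].
pose A : {fset 'rV[R]_d} := [fset x in [seq \row_l F l (node t) | t <- enum T]]%fset.
have AE x : (x \in A) = (x \in [seq \row_l F l (node t) | t <- enum T]) by rewrite in_fset.
have AK : [set` A] `<=` K.
  by move=> x /=; rewrite AE => /mapP[t _ ->]; exists (node t).
exists A; split=> //.
  have : (#|` A| <= M1.+1 ^ d1 * M2.+1 ^ (d2 + d3))%N.
    rewrite card_fseq (leq_trans (size_undup _))// size_map -cardE.
    by rewrite card_prod !card_ffun !card_ord.
  by rewrite -lez_nat -![Posz _]natz natrM !natrX.
move=> _ [q /= sq <-].
pose P (x : X) := mpoly.meval (F^~ x) q.
have mP : multi_poly (fun=> n) P by exact: multi_poly_meval.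
have PE x : mpoly.meval ((\row_l F l x : 'rV[R]_d) ord0) q = P x.
  by rewrite /P; congr mpoly.meval; apply/funext => l; rewrite mxE.
pose c (j : 'I_d1 + 'I_(d2 + d3)) :=
  if j is inr i then if (i < d2)%N then alpha else beta else alpha.
have a1 : 1 < alpha by exact: inv_cos_gt1.
have ab' : alpha <= beta by exact: inv_cos_le.
have c0 j : 0 <= c j.
  by case: j => [i|i] /=; [|case: ifP => _]; lra.
apply: supnorm_le.
- by have [x xB] := box_nonempty; exists (\row_l F l x); exists x.
- exact: fset_has_ubound.
- by rewrite mulr_ge0// exprn_ge0; lra.
move=> _ [x xB <-].
pose N (j : 'I_d1 + 'I_(d2 + d3)) : set R :=
  match j with inl i => range (Y i) | inr i => range (Z i) end.
have [|||z' z'N] := @coordinatewise_sampling R _ (P \o (@point_of R d1 (d2 + d3)))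
  (fun j => [set y | lower a u j <= y <= upper b v j]) N c c0 _ _ (coord_of x).
- case=> i _ [k _ <-] /=; [exact: (YP i).1|exact: (ZP i).1].
- move=> j z zB; have := mP.2 z j.
  have zE : P (point_of z) = P (point_of (update z j (z j))).
    by congr (P (point_of _)); apply/funext => i; rewrite /update; case: eqP => [->|].
  rewrite /= zE; case: j zB zE => i zB _ sec.
    have [k kP] := (YP i).2 _ sec _ (zB (inl i)).
    by exists (Y i k); first exists k.
  have [k kP] := (ZP i).2 _ sec _ (zB (inr i)).
  by exists (Z i k); first exists k.
- exact/box_coord.
rewrite prod_coordinate_constants /= coord_ofK => z'P.
have fE i : exists k, Y i k = z' (inl i) by have [k _ <-] := z'N (inl i); exists k.
have gE i : exists k, Z i k = z' (inr i) by have [k _ <-] := z'N (inr i); exists k.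
have {fE}[f fE] := choice fE; have {gE}[g gE] := choice gE.
have nE : node (finfun f, finfun g) = point_of z'.
  by congr pair; apply/rowP => i; rewrite !mxE ffunE ?fE ?gE.
exists (\row_l F l (point_of z')).
  by rewrite /= AE; apply/mapP; exists (finfun f, finfun g); rewrite ?nE// mem_enum.
rewrite !patchE !mem_set ?PE//; last by exists x.
by exists (point_of z') => //; rewrite -nE.
Qed.

(** Two distinct points of K differ in some coordinate, which therefore takes on K all the values
    of an interval. *)
Lemma ldim_image_gt n (x y : 'rV[R]_d) : K x -> K y -> x != y ->
  (n < ldim (mpoly_space n K))%N.
Proof.
move=> [x0 x0B <-] [x1 x1B <-] /eqP xy.
have [l Fl] : exists l, F l x1 != F l x0.
  apply: contrapT => Fl; apply: xy; apply/rowP => l; rewrite !mxE.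
  by apply: contrapT => /eqP Flx; apply: Fl; exists l; rewrite eq_sym.
have [v0 [v1 [v01 vP]]] := multi_poly_values (mF l) x0B x1B Fl.
pose t (i : 'I_n.+1) : R := v0 + (v1 - v0) * (i%:R / n.+1%:R).
have n1 : 0 < n.+1%:R :> R by rewrite ltr0n.
apply: (@ldim_mpoly_space_gt _ _ _ _ l [seq t i | i <- enum 'I_n.+1]).
- rewrite map_inj_uniq ?enum_uniq// => i j /addrI.
  have vne : v1 - v0 != 0 by rewrite subr_eq0 gt_eqF.
  have nne : n.+1%:R != 0 :> R by rewrite gt_eqF.
  by move=> /(mulfI vne) /(mulIf (invr_neq0 nne)) /eqP; rewrite eqr_nat => /eqP/val_inj.
- by rewrite size_map size_enum_ord.
move=> _ /mapP[i _ ->].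
have ti : 0 <= (i%:R / n.+1%:R : R) <= 1.
  by rewrite divr_ge0//= ler_pdivrMr// mul1r ler_nat ltnW.
have [z zB zE] : exists2 x, B x & F l x = t i.
  have w0 : 0 <= v1 - v0 by rewrite subr_ge0 ltW.
  case/andP: ti => /(mulr_ge0 w0) t0 /(ler_wpM2l w0); rewrite mulr1 => t1.
  by apply: vP; rewrite /t lerDl t0 /= -lerBrDl.
by exists (\row_l F l z); rewrite ?mxE//; exists z.
Qed.

End Mesh.

Theorem proposition1 (R : realType) (d d1 d2 d3 : nat)
    (a b : 'I_d1 -> R) (u v : 'I_(d2 + d3) -> R)
    (sigma : 'I_d -> 'rV[R]_d1 * 'rV[R]_(d2 + d3) -> R)
    (K : set 'rV[R]_d) (m : R) :
  (1 <= d)%N ->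
  (1 <= d1 + d2 + d3)%N ->
  (forall i, a i < b i) ->
  (forall j : 'I_(d2 + d3), (j < d2)%N -> v j - u j = 2 * pi) ->
  (forall j : 'I_(d2 + d3), (d2 <= j)%N -> 0 < v j - u j < 2 * pi) ->
  (forall l, tensor_space (fun i => poly_space 1 (a i) (b i))
                          (fun j => trig_space 1 (u j) (v j))
                          (sigma l \_ (box a b `*` box u v))) ->
  K = [set \row_l sigma l x | x in box a b `*` box u v] ->
  1 < m ->
  let alpha := 1 / cos (pi / (2 * m)) in
  let beta := m / (m - 1) in
  exists A : nat -> {fset 'rV[R]_d},
    polynomial_mesh K (alpha ^+ (d1 + d2) * beta ^+ d3) A /\
    forall n, (1 <= n)%N ->
      let N1 := Num.ceil (m * n%:R + 1) in
      let N2 := Num.ceil (2 * m * n%:R + 1) in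
      #|` A n|%:Z <= N1 ^+ d1 * N2 ^+ (d2 + d3).
Proof.
move=> _ d123 ab uv_circle uv_arc tsigma KE m1 alpha beta.
have FE l : exists F : 'rV[R]_d1 * 'rV[R]_(d2 + d3) -> R, multi_poly (fun=> 1%N) F /\
    forall x, (box a b `*` box u v) x -> sigma l x = F x.
  have [F mF sF] := tensor_multi_poly (tsigma l); exists F; split=> // x xB.
  by rewrite -sF// patchE mem_set.
have {FE}[F FE] := choice FE.
have mF l : multi_poly (fun=> 1%N) (F l) by case: (FE l).
have {}KE : K = [set \row_l F l x | x in box a b `*` box u v].
  rewrite KE; apply/seteqP; split=> _ [x xB <-]; exists x => //; apply/rowP => l.
    by rewrite !mxE (FE l).2.
  by rewrite !mxE (FE l).2.
have meshE n : exists A : {fset 'rV[R]_d}, (0 < n)%N -> [/\ [set` A] `<=` K,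
    #|` A|%:Z <= Num.ceil (m * n%:R + 1) ^+ d1 *
                 Num.ceil (2 * m * n%:R + 1) ^+ (d2 + d3) &
    forall p, mpoly_space n K p ->
      supnorm K p <= alpha ^+ (d1 + d2) * beta ^+ d3 * supnorm [set` A] p].
  case: n => [|n]; first by exists fset0.
  by have [A AP] := mesh_exists ab uv_circle uv_arc m1 mF (ltn0Sn n); exists A => _; rewrite KE.
have {meshE}[A AP] := choice meshE.
exists A; split; last by move=> n /AP[].
have a1 : 1 < alpha by exact: inv_cos_gt1.
have b1 : 1 < beta by rewrite (lt_le_trans a1)// inv_cos_le.
split.
- by rewrite KE; exact: compact_image.
- have a0 : 0 <= alpha ^+ (d1 + d2) by rewrite exprn_ge0//; lra.
  have [d12|d12] := posnP (d1 + d2)%N.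
    by rewrite d12 expr0 mul1r exprn_egt1//; lia.
  rewrite (@lt_le_trans _ _ (alpha ^+ (d1 + d2)))//.
    by rewrite exprn_egt1// -lt0n.
  by rewrite ler_peMr// exprn_ege1// ltW.
- by move=> n /AP[].
- by move=> n /AP[].
have D0 : (0 < d1 + (d2 + d3))%N by rewrite addnA.
pose D := (d1 + (d2 + d3))%N.
pose C : R := (2 * m + 2) ^+ D.
have C1 : 1 <= C by rewrite exprn_ege1//; lra.
exists D%:R; first by rewrite ler1n.
apply: (@bigO_le _ _ _ C) => [|n n0]; first by rewrite (lt_le_trans ltr01).
have [AK Acard _] := AP n n0.
rewrite powR_mulrn// !ger0_norm ?exprn_ge0//.
(* When K is a single point its polynomial spaces have dimension 1 for all n, and the cardinality
   of the meshes is bounded because they are subsets of K. *)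
have [[x [y [Kx Ky xy]]]|K1] := pselect (exists x y, [/\ K x, K y & x != y]).
  have dimn : (n < ldim (mpoly_space n K))%N.
    by move: Kx Ky xy; rewrite KE; exact: ldim_image_gt.
  have n1R : n%:R + 1 <= (ldim (mpoly_space n K))%:R :> R by rewrite natr1 ler_nat.
  have n0R : 0 <= n%:R :> R by [].
  have mn0 : 0 <= m * n%:R by rewrite mulr_ge0//; lra.
  have ceilP (x0 : R) : 0 <= x0 -> x0 <= 2 * m * n%:R ->
      (0 : R) <= (Num.ceil (x0 + 1))%:~R <= (2 * m + 2) * (ldim (mpoly_space n K))%:R.
    move=> x00 x0m; apply/andP; split; first by rewrite ler0z ceil_ge0; lra.
    have := ceilB1_lt (x0 + 1); rewrite intrB => cl.
    have : (2 * m + 2) * (n%:R + 1) <= (2 * m + 2) * (ldim (mpoly_space n K))%:R.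
      by rewrite ler_wpM2l//; lra.
    by lra.
  have := Acard; rewrite -(ler_int R) => /le_trans; apply.
  rewrite intrM !rmorphXn /= /C -exprMn /D [leRHS]exprD.
  have /andP[c10 c1] := ceilP (m * n%:R) mn0 ltac:(lra).
  have /andP[c20 c2] := ceilP (2 * m * n%:R) ltac:(lra) (lexx _).
  by rewrite ler_pM ?exprn_ge0// lerXn2r// nnegrE// (le_trans c10).
have K0 : K !=set0.
  rewrite KE; have [x xB] := box_nonempty ab uv_circle uv_arc.
  by exists (\row_l F l x), x.
have A1 : (#|` A n| <= 1)%N.
  have [x0 x0K] := K0.
  suff : (#|` A n| <= #|` [fset x0]%fset|)%N by rewrite cardfs1.
  apply: fsubset_leq_card; apply/fsubsetP => x xA.
  rewrite inE; apply: contrapT => /negP xx0; apply: K1; exists x, x0; split=> //.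
  exact: AK.
rewrite (@le_trans _ _ 1) ?lern1// mulr_ege1// exprn_ege1// ler1n.
exact: ldim_mpoly_space_gt0.
Qed.
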